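(* Let $G$ be the graph consisting of a triangle on vertices $a,b,c$ together with four pendant vertices (degree-one vertices) attached to each of $a$, $b$ and $c$ (so $a,b,c$ have degree $6$). Consider the planar embedding of $G$ in which the four pendant edges at $a$ and the four pendant edges at $b$ lie outside the triangle, while the four pendant edges at $c$ lie inside the triangle. Then $G$ has no planar Lombardi drawing for this embedding.
   Context: A Lombardi drawing maps each vertex to a point and each edge to a circular arc or line segment joining the points of its endpoints, such that at each vertex $v$ the incident arcs are equally spaced around $v$, consecutive arcs forming angles $2\pi/\deg(v)$. It is planar if the only intersection points of its arcs are shared endpoints; a Lombardi drawing for a given embedding is one whose rotation of arcs around each vertex and whose faces agree with that embedding. *)

(* Defs.v *)
From Stdlib Require Import Reals Lra List Permutation.
Open Scope R_scope.

Definition pt := (R * R)%type.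

(* A drawn edge: either a straight segment from P to Q, or a circular arc
   with center (cx,cy), radius r > 0, starting angle phi, signed sweep
   delta (0 < |delta| < 2 PI), traversed counterclockwise if delta > 0. *)
Inductive arc : Type :=
| Seg (P Q : pt)
| Circ (cx cy r phi delta : R).

Definition arc_param (g : arc) (t : R) : pt :=
  match g with
  | Seg P Q => (fst P + t * (fst Q - fst P), snd P + t * (snd Q - snd P))
  | Circ cx cy r phi delta =>
      (cx + r * cos (phi + t * delta), cy + r * sin (phi + t * delta))
  end.

Definition arc_wf (g : arc) : Prop :=
  match g with
  | Seg P Q => P <> Q
  | Circ _ _ r _ delta => 0 < r /\ delta <> 0 /\ - (2 * PI) < delta < 2 * PI
  end.

Definition arc_start (g : arc) : pt := arc_param g 0.
Definition arc_end (g : arc) : pt := arc_param g 1.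

Definition arc_image (g : arc) (x : pt) : Prop :=
  exists t, 0 <= t <= 1 /\ arc_param g t = x.

(* Tangent vector of the arc leaving its start point (= derivative of the
   parametrization at t = 0, up to the positive factor r), and leaving its
   end point (= minus the derivative at t = 1, up to the factor r). *)
Definition dir_start (g : arc) : pt :=
  match g with
  | Seg P Q => (fst Q - fst P, snd Q - snd P)
  | Circ _ _ _ phi delta => (- delta * sin phi, delta * cos phi)
  end.

Definition dir_end (g : arc) : pt :=
  match g with
  | Seg P Q => (fst P - fst Q, snd P - snd Q)
  | Circ _ _ _ phi delta =>
      (delta * sin (phi + delta), - delta * cos (phi + delta))
  end.

Definition equally_spaced (ds : list pt) : Prop :=
  let k := length ds in
  exists (theta : R) (ord : list pt),
    Permutation ds ord /\
    forall j : nat, (j < k)%nat ->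
      exists lam : R, 0 < lam /\
        nth j ord (0, 0) =
          (lam * cos (theta + 2 * PI * INR j / INR k),
           lam * sin (theta + 2 * PI * INR j / INR k)).

(* Continuous paths in the plane (parametrized by [0,1], extended to R). *)
Definition cont_path (gam : R -> pt) : Prop :=
  continuity (fun t => fst (gam t)) /\ continuity (fun t => snd (gam t)).

(* x lies in the unbounded component of the complement of the set T:
   x is not on T and can be joined, avoiding T, to points arbitrarily far. *)
Definition outside_of (T : pt -> Prop) (x : pt) : Prop :=
  ~ T x /\
  forall M : R, exists gam : R -> pt,
    cont_path gam /\ gam 0 = x /\
    (fst (gam 1) ^ 2 + snd (gam 1) ^ 2 > M) /\
    (forall t, 0 <= t <= 1 -> ~ T (gam t)).

Definition inside_of (T : pt -> Prop) (x : pt) : Prop :=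
  ~ T x /\ ~ outside_of T x.

Inductive hub : Type := HA | HB | HC.
Inductive idx4 : Type := I0 | I1 | I2 | I3.

Inductive vert : Type :=
| Hub (h : hub)
| Leaf (h : hub) (i : idx4).

Inductive edge : Type :=
| Tri (h : hub)              (* Tri HA = ab, Tri HB = bc, Tri HC = ca *)
| Pen (h : hub) (i : idx4).

Definition next_hub (h : hub) : hub :=
  match h with HA => HB | HB => HC | HC => HA end.

(* Endpoints of an edge (the order is only a convention fixing the direction
   in which the drawn arc is parametrized). *)
Definition ends (e : edge) : vert * vert :=
  match e with
  | Tri h => (Hub h, Hub (next_hub h))
  | Pen h i => (Hub h, Leaf h i)
  end.

Definition all_hubs : list hub := HA :: HB :: HC :: nil.
Definition all_idx : list idx4 := I0 :: I1 :: I2 :: I3 :: nil.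
Definition all_edges : list edge :=
  map Tri all_hubs ++
  flat_map (fun h => map (Pen h) all_idx) all_hubs.

Lemma hub_eq_dec : forall x y : hub, {x = y} + {x <> y}.
Proof. decide equality. Defined.
Lemma idx4_eq_dec : forall x y : idx4, {x = y} + {x <> y}.
Proof. decide equality. Defined.
Lemma vert_eq_dec : forall x y : vert, {x = y} + {x <> y}.
Proof. decide equality; first [apply hub_eq_dec | apply idx4_eq_dec]. Defined.

Definition incident_dirs (drw : edge -> arc) (v : vert) : list pt :=
  flat_map (fun e =>
     (if vert_eq_dec (fst (ends e)) v then dir_start (drw e) :: nil else nil)
  ++ (if vert_eq_dec (snd (ends e)) v then dir_end (drw e) :: nil else nil))
    all_edges.

Definition is_drawing (pos : vert -> pt) (drw : edge -> arc) : Prop :=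
  (forall u v, pos u = pos v -> u = v) /\
  (forall e, arc_wf (drw e) /\
             arc_start (drw e) = pos (fst (ends e)) /\
             arc_end (drw e) = pos (snd (ends e))).

Definition is_lombardi (pos : vert -> pt) (drw : edge -> arc) : Prop :=
  is_drawing pos drw /\ forall v, equally_spaced (incident_dirs drw v).

Definition is_planar (pos : vert -> pt) (drw : edge -> arc) : Prop :=
  forall e f : edge, e <> f -> forall x : pt,
    arc_image (drw e) x -> arc_image (drw f) x ->
    exists w : vert,
      (w = fst (ends e) \/ w = snd (ends e)) /\
      (w = fst (ends f) \/ w = snd (ends f)) /\ x = pos w.

Definition triangle_set (drw : edge -> arc) (x : pt) : Prop :=
  exists h, arc_image (drw (Tri h)) x.

Definition respects_embedding (drw : edge -> arc) : Prop :=
  forall (h : hub) (i : idx4) (t : R), 0 < t <= 1 ->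
    match h with
    | HC => inside_of (triangle_set drw) (arc_param (drw (Pen h i)) t)
    | _ => outside_of (triangle_set drw) (arc_param (drw (Pen h i)) t)
    end.

(* Main.v *)
Require Import Defs.
From Stdlib Require Import Reals Lra Lia List Permutation.
From Coquelicot Require Import Coquelicot.
Open Scope R_scope.

(** A segment or arc from [a] to [b] is the locus where
    [(x - b) * conj (x - a) * cis (- 2 th)] is a nonpositive real, [4 th] being
    its signed sweep.  The points of the complement of the triangle that lie close
    to it on a given side can be joined to each other by sliding along the arcs,
    and the two sides are separated by a function [side] that is continuous and
    nonzero off the curve, changes sign across it, and is positive far away.  Hence
    all pendant edges at [a] and [b] leave on the side where [side] is positive and
    those at [c] on the other one, so the two triangle edges make an angle of 60
    degrees at each of the three vertices, with the turn at [c] opposite to the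
    turns at [a] and [b].  Multiplying the three angle conditions shows that the
    circle through the arc [ab] then passes through [c].  Either [c] lies on that
    arc, or the arcs [ca] and [bc] meet in a second point; both contradict
    planarity. *)

(** The argument of [(x - b) * conj (x - a)] is the oriented angle from [x - a] to [x - b], constant
    on an open arc by the inscribed angle theorem. The sweep is divided by four because the tangent
    at an end makes half the sweep with the chord, and the square roots inside [side] halve once
    more. The obstacle is topological: the embedding is given by paths in the complement, and
    [inside_of] is merely the negation of [outside_of], so a piece of the Jordan curve theorem for
    arc triangles has to be supplied by hand. Only one implication is proved: points outside have
    positive [side]. The converse is bypassed at [c], where a pendant edge on the wrong side is
    joined to a pendant edge of [a], which is outside. At a vertex the functions of both adjacent
    arcs vanish. They are therefore divided by the distance to the vertex, or by the parameter along
    the arc, before any continuity argument. *)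

(** * Complex arithmetic: unit vectors and the slit along the negative real axis *)

(** Zero exactly on the nonpositive real axis and positive elsewhere, so lying on an arc becomes the
    vanishing of one continuous nonnegative function. *)
Definition slit (w : C) : R := Cmod w + Re w.

Definition cis (t : R) : C := (cos t, sin t).

(** The principal square root of [w] times a nonnegative factor. The factor vanishes on the cut,
    which makes the function continuous everywhere. *)
Definition add_mod (w : C) : C := (w + Cmod w)%C.

Lemma C_eq (z w : C) : Re z = Re w -> Im z = Im w -> z = w.
Proof. destruct z, w; simpl; intros; subst; reflexivity. Qed.

Lemma Re_mult (z w : C) : Re (z * w) = Re z * Re w - Im z * Im w.
Proof. reflexivity. Qed.

Lemma Im_mult (z w : C) : Im (z * w) = Re z * Im w + Im z * Re w.
Proof. reflexivity. Qed.

Lemma Re_plus (z w : C) : Re (z + w) = Re z + Re w.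
Proof. reflexivity. Qed.

Lemma Im_plus (z w : C) : Im (z + w) = Im z + Im w.
Proof. reflexivity. Qed.

Lemma Re_minus (z w : C) : Re (z - w) = Re z - Re w.
Proof. reflexivity. Qed.

Lemma Im_minus (z w : C) : Im (z - w) = Im z - Im w.
Proof. reflexivity. Qed.

Lemma Re_opp (z : C) : Re (- z) = - Re z.
Proof. reflexivity. Qed.

Lemma Re_scal (r : R) (z : C) : Re (r * z) = r * Re z.
Proof. unfold Re; simpl; ring. Qed.

Lemma Im_scal (r : R) (z : C) : Im (r * z) = r * Im z.
Proof. unfold Im; simpl; ring. Qed.

Lemma Re_RtoC (r : R) : Re r = r.
Proof. reflexivity. Qed.

Lemma Im_RtoC (r : R) : Im r = 0.
Proof. reflexivity. Qed.

Lemma RtoC_real (z : C) : Im z = 0 -> z = RtoC (Re z).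
Proof. intros H; apply C_eq; simpl; auto. Qed.

Lemma conj_RtoC (r : R) : Cconj r = r.
Proof. apply C_eq; simpl; lra. Qed.

Lemma mult_conj (z : C) : (z * Cconj z)%C = RtoC (Cmod z ^ 2).
Proof. symmetry; exact (Cmod2_conj z). Qed.

Lemma RtoC_neq_0 (r : R) : r <> 0 -> RtoC r <> 0%C.
Proof. intros H E; apply H; now apply RtoC_inj. Qed.

Lemma Cinv_neq_0 (z : C) : z <> 0%C -> (/ z)%C <> 0%C.
Proof.
intros H E; generalize (Cinv_r z H); rewrite E, Cmult_0_r.
intros K; apply RtoC_inj in K; lra.
Qed.

Lemma Cmult_cancel_r (z w u : C) : u <> 0%C -> (z * u)%C = (w * u)%C -> z = w.
Proof.
intros H E; replace z with (z * u * / u)%C by (field; exact H).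
rewrite E; field; exact H.
Qed.

Lemma Cminus_neq_0 (z w : C) : z <> w -> (z - w)%C <> 0%C.
Proof. intros H E; apply H; replace z with ((z - w) + w)%C by ring; rewrite E; ring. Qed.

Lemma cis_plus (s t : R) : cis (s + t) = (cis s * cis t)%C.
Proof.
apply C_eq; unfold cis; simpl; [rewrite cos_plus | rewrite sin_plus]; ring.
Qed.

Lemma cis_opp (t : R) : cis (- t) = Cconj (cis t).
Proof. apply C_eq; unfold cis; simpl; [apply cos_neg | apply sin_neg]. Qed.

Lemma cis_0 : cis 0 = 1%C.
Proof. apply C_eq; simpl; [apply cos_0 | apply sin_0]. Qed.

Lemma cis_opp_l (t : R) : (cis (- t) * cis t)%C = 1%C.
Proof. rewrite <- cis_plus; replace (- t + t) with 0 by ring; apply cis_0. Qed.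

Lemma cis_opp_r (t : R) : (cis t * cis (- t))%C = 1%C.
Proof. rewrite Cmult_comm; apply cis_opp_l. Qed.

Lemma cis_neq_0 (t : R) : cis t <> 0%C.
Proof.
intros E; generalize (cis_opp_l t); rewrite E, Cmult_0_r.
intros H; apply RtoC_inj in H; lra.
Qed.

Lemma Cmod_cis (t : R) : Cmod (cis t) = 1.
Proof.
unfold Cmod, cis; simpl.
replace (cos t * (cos t * 1) + sin t * (sin t * 1)) with 1.
- apply sqrt_1.
- generalize (sin2_cos2 t); unfold Rsqr; lra.
Qed.

Lemma cis_2 (t : R) : cis (2 * t) = (cis t * cis t)%C.
Proof. rewrite <- cis_plus; f_equal; ring. Qed.

Lemma Re_le_Cmod (w : C) : - Cmod w <= Re w <= Cmod w.
Proof. apply Rabs_le_between; apply re_le_Cmod. Qed.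

Lemma slit_ge_0 (w : C) : 0 <= slit w.
Proof. unfold slit; generalize (Re_le_Cmod w); lra. Qed.

Lemma slit_eq_0 (w : C) : slit w = 0 <-> Im w = 0 /\ Re w <= 0.
Proof.
unfold slit; generalize (Cmod2_alt w) (Cmod_ge_0 w); intros H H0; split.
- intros K; assert (E : Cmod w = - Re w) by lra; rewrite E in H; nra.
- intros [E L]; rewrite E in H.
  assert (K : (Cmod w - Re w) * (Cmod w + Re w) = 0) by nra.
  destruct (Rmult_integral _ _ K); lra.
Qed.

Lemma slit_pos_neq (w : C) : 0 < slit w <-> slit w <> 0.
Proof. generalize (slit_ge_0 w); lra. Qed.

Lemma slit_scal (r : R) (w : C) : 0 <= r -> slit (r * w)%C = r * slit w.
Proof.
intros Hr; unfold slit; rewrite Cmod_mult, Cmod_R, Rabs_pos_eq, Re_scal by exact Hr.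
ring.
Qed.

Lemma slit_opp_cis (t : R) : slit (- cis t)%C = 1 - cos t.
Proof. unfold slit; rewrite Cmod_opp, Cmod_cis, Re_opp; reflexivity. Qed.

Lemma add_mod_scal (r : R) (w : C) :
  0 <= r -> add_mod (r * w)%C = (r * add_mod w)%C.
Proof.
intros Hr; unfold add_mod; rewrite Cmod_mult, Cmod_R, Rabs_pos_eq by exact Hr.
rewrite RtoC_mult; ring.
Qed.

Lemma add_mod_sqr (w : C) :
  (add_mod w * add_mod w)%C = ((2 * slit w)%R * w)%C.
Proof.
unfold add_mod, slit; generalize (Cmod2_alt w); intros H; apply C_eq.
- rewrite Re_scal, Re_mult, Re_plus, Im_plus, Re_RtoC, Im_RtoC; nra.
- rewrite Im_scal, Im_mult, Re_plus, Im_plus, Re_RtoC, Im_RtoC; nra.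
Qed.

(** * Continuity of complex-valued functions *)

Definition Ccts {U : UniformSpace} (f : U -> C) (x : U) : Prop :=
  continuous (fun u => Re (f u)) x /\ continuous (fun u => Im (f u)) x.

Section Continuity.
Context {U : UniformSpace}.
Implicit Types (f g : U -> R) (F G : U -> C) (x : U).

Lemma cts_plus f g x :
  continuous f x -> continuous g x -> continuous (fun u => f u + g u) x.
Proof. exact (continuous_plus (K := R_AbsRing) (V := R_NormedModule) f g x). Qed.

Lemma cts_opp f x : continuous f x -> continuous (fun u => - f u) x.
Proof. exact (continuous_opp (K := R_AbsRing) (V := R_NormedModule) f x). Qed.

Lemma cts_minus f g x :
  continuous f x -> continuous g x -> continuous (fun u => f u - g u) x.
Proof. intros; apply cts_plus; [|apply cts_opp]; assumption. Qed.

Lemma cts_mult f g x :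
  continuous f x -> continuous g x -> continuous (fun u => f u * g u) x.
Proof. exact (continuous_mult (K := R_AbsRing) f g x). Qed.

Lemma cts_const (c : R) x : continuous (fun _ : U => c) x.
Proof. apply continuous_const. Qed.

Lemma cts_comp (h : R -> R) f x :
  continuous f x -> continuous h (f x) -> continuous (fun u => h (f u)) x.
Proof. exact (continuous_comp f h x). Qed.

Lemma cts_inv f x : continuous f x -> f x <> 0 -> continuous (fun u => / f u) x.
Proof. intros H H0; apply (cts_comp Rinv f x H); now apply continuous_Rinv. Qed.

Lemma Ccts_const (c : C) x : Ccts (fun _ : U => c) x.
Proof. split; apply cts_const. Qed.

Lemma Ccts_plus F G x : Ccts F x -> Ccts G x -> Ccts (fun u => F u + G u)%C x.
Proof. intros [? ?] [? ?]; split; apply cts_plus; assumption. Qed.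

Lemma Ccts_opp F x : Ccts F x -> Ccts (fun u => - F u)%C x.
Proof. intros [? ?]; split; apply cts_opp; assumption. Qed.

Lemma Ccts_minus F G x : Ccts F x -> Ccts G x -> Ccts (fun u => F u - G u)%C x.
Proof. intros; apply Ccts_plus; [|apply Ccts_opp]; assumption. Qed.

Lemma Ccts_mult F G x : Ccts F x -> Ccts G x -> Ccts (fun u => F u * G u)%C x.
Proof.
intros [? ?] [? ?]; split;
  [apply cts_minus | apply cts_plus]; apply cts_mult; assumption.
Qed.

Lemma Ccts_conj F x : Ccts F x -> Ccts (fun u => Cconj (F u)) x.
Proof. intros [? ?]; split; [|apply cts_opp]; assumption. Qed.

Lemma Ccts_RtoC f x : continuous f x -> Ccts (fun u => RtoC (f u)) x.
Proof. intros H; split; [exact H | apply cts_const]. Qed.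

Lemma Ccts_pair f g x :
  continuous f x -> continuous g x -> Ccts (fun u => (f u, g u)) x.
Proof. intros; split; assumption. Qed.

Lemma Ccts_cis f x : continuous f x -> Ccts (fun u => cis (f u)) x.
Proof.
intros H; split; [apply (cts_comp cos) | apply (cts_comp sin)];
  auto using continuous_cos, continuous_sin.
Qed.

Lemma cts_Cmod F x : Ccts F x -> continuous (fun u => Cmod (F u)) x.
Proof.
intros [H1 H2]; apply (cts_comp sqrt); [|apply continuous_sqrt].
apply cts_plus; simpl;
  apply cts_mult; try assumption; apply cts_mult; try assumption; apply cts_const.
Qed.

Lemma cts_Re F x : Ccts F x -> continuous (fun u => Re (F u)) x.
Proof. intros [? ?]; assumption. Qed.

Lemma cts_Im F x : Ccts F x -> continuous (fun u => Im (F u)) x.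
Proof. intros [? ?]; assumption. Qed.

Lemma cts_slit F x : Ccts F x -> continuous (fun u => slit (F u)) x.
Proof. intros H; apply cts_plus; [now apply cts_Cmod | now apply cts_Re]. Qed.

Lemma Ccts_add_mod F x : Ccts F x -> Ccts (fun u => add_mod (F u)) x.
Proof. intros H; apply Ccts_plus; [|apply Ccts_RtoC, cts_Cmod]; assumption. Qed.

Lemma Ccts_inv F x : Ccts F x -> F x <> 0%C -> Ccts (fun u => / F u)%C x.
Proof.
intros [H1 H2] H0.
assert (N : (fst (F x) ^ 2 + snd (F x) ^ 2) <> 0).
{ intros E; apply H0, Cmod_eq_0; generalize (Cmod2_alt (F x)); unfold Re, Im; nra. }
assert (K : continuous (fun u => / (fst (F u) ^ 2 + snd (F u) ^ 2)) x).
{ apply cts_inv; [|exact N]; apply cts_plus; simpl;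
    apply cts_mult; try assumption; apply cts_mult; try assumption; apply cts_const. }
split; simpl; apply cts_mult; try assumption; now apply cts_opp.
Qed.

Lemma Ccts_div F G x :
  Ccts F x -> Ccts G x -> G x <> 0%C -> Ccts (fun u => F u / G u)%C x.
Proof. intros; apply Ccts_mult; [|apply Ccts_inv]; assumption. Qed.

End Continuity.

Lemma cts_id (x : R) : continuous (fun u : R => u) x.
Proof. apply continuous_id. Qed.

Lemma cts_fst {U V : UniformSpace} (x : U * V) : continuous (fun u : U * V => fst u) x.
Proof. destruct x; apply continuous_fst. Qed.

Lemma cts_snd {U V : UniformSpace} (x : U * V) : continuous (fun u : U * V => snd u) x.
Proof. destruct x; apply continuous_snd. Qed.

Lemma cts_fst_snd {U V W : UniformSpace} (x : U * (V * W)) :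
  continuous (fun u : U * (V * W) => fst (snd u)) x.
Proof. apply (continuous_comp (fun u : U * (V * W) => snd u)); [apply cts_snd | apply cts_fst]. Qed.

Lemma cts_snd_snd {U V W : UniformSpace} (x : U * (V * W)) :
  continuous (fun u : U * (V * W) => snd (snd u)) x.
Proof. apply (continuous_comp (fun u : U * (V * W) => snd u)); [apply cts_snd | apply cts_snd]. Qed.

Ltac cts :=
  lazymatch goal with
  | |- Ccts (fun _ => ?c) _ => apply Ccts_const
  | |- Ccts (fun u => Cplus (@?F u) (@?G u)) _ => apply (Ccts_plus F G); cts
  | |- Ccts (fun u => Cminus (@?F u) (@?G u)) _ => apply (Ccts_minus F G); cts
  | |- Ccts (fun u => Cmult (@?F u) (@?G u)) _ => apply (Ccts_mult F G); cts
  | |- Ccts (fun u => Cdiv (@?F u) (@?G u)) _ => apply (Ccts_div F G); [cts | cts |]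
  | |- Ccts (fun u => Copp (@?F u)) _ => apply (Ccts_opp F); cts
  | |- Ccts (fun u => Cconj (@?F u)) _ => apply (Ccts_conj F); cts
  | |- Ccts (fun u => cis (@?F u)) _ => apply (Ccts_cis F); cts
  | |- Ccts (fun u => add_mod (@?F u)) _ => apply (Ccts_add_mod F); cts
  | |- Ccts (fun u => RtoC (@?F u)) _ => apply (Ccts_RtoC F); cts
  | |- Ccts (fun u => (@?F u, @?G u)) _ => apply (Ccts_pair F G); cts
  | |- continuous (fun _ => ?c) _ => apply cts_const
  | |- continuous (fun u => u) _ => apply cts_id
  | |- continuous (fun u => fst u) _ => apply cts_fst
  | |- continuous (fun u => snd u) _ => apply cts_snd
  | |- continuous (fun u => fst (snd u)) _ => apply cts_fst_snd
  | |- continuous (fun u => snd (snd u)) _ => apply cts_snd_snd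
  | |- continuous (fun u => Rplus (@?F u) (@?G u)) _ => apply (cts_plus F G); cts
  | |- continuous (fun u => Rminus (@?F u) (@?G u)) _ => apply (cts_minus F G); cts
  | |- continuous (fun u => Rmult (@?F u) (@?G u)) _ => apply (cts_mult F G); cts
  | |- continuous (fun u => Ropp (@?F u)) _ => apply (cts_opp F); cts
  | |- continuous (fun u => slit (@?F u)) _ => apply (cts_slit F); cts
  | |- continuous (fun u => Cmod (@?F u)) _ => apply (cts_Cmod F); cts
  | |- continuous (fun u => Re (@?F u)) _ => apply (cts_Re F); cts
  | |- continuous (fun u => Im (@?F u)) _ => apply (cts_Im F); cts
  | _ => idtac
  end.

(** * Persistence of positivity near a point and along a compact interval *)

Lemma continuous_pos {U : UniformSpace} (f : U -> R) (x : U) :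
  continuous f x -> 0 < f x -> exists d : posreal, forall y, ball x d y -> 0 < f y.
Proof.
intros H Hp.
destruct (H (fun y => 0 < y)) as [d Hd].
- exists (mkposreal _ Hp); intros y Hy.
  apply Rabs_lt_between' in Hy; simpl in Hy; lra.
- now exists d.
Qed.

(** Compactness: the minimum on the slice is positive, and uniform continuity keeps [f] above zero
    in a strip of constant width. It serves for turning about a vertex, for sliding along an arc and
    for the behaviour at infinity. *)
Lemma tube (f : R * R -> R) (a b c : R) :
  (forall t, a <= t <= b -> continuous f (t, c)) ->
  (forall t, a <= t <= b -> 0 < f (t, c)) ->
  exists d, 0 < d /\ forall t v, a <= t <= b -> Rabs (v - c) < d -> 0 < f (t, v).
Proof.
intros Hc Hp.
destruct (Rle_dec a b) as [Hab|Hab].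
2: { exists 1; split; [lra|]; intros; lra. }
destruct (continuity_ab_min (fun t => f (t, c)) a b Hab) as (m & Hm & Im).
{ intros t Ht; apply continuity_pt_filterlim.
  apply (continuous_comp_2 (fun t => t) (fun _ => c) (fun x y => f (x, y))).
  - apply cts_id.
  - apply cts_const.
  - apply (continuous_ext f (fun z => f (fst z, snd z))); [now intros []|]; now apply Hc. }
set (e := mkposreal _ (Hp m Im)).
destruct (uniform_continuity_2d_1d (fun x y => f (x, y)) a b c) with (eps := e)
  as [d Hd].
{ intros x Hx; apply continuity_2d_pt_filterlim.
  apply (continuous_ext f (fun z => f (fst z, snd z))); [now intros []|]; now apply Hc. }
exists d; split; [apply cond_pos|]; intros t v Ht Hv.
apply Rabs_lt_between' in Hv.
generalize (cond_pos d); intros Hd0.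
specialize (Hd t c t v Ht).
assert (K : Rabs (f (t, v) - f (t, c)) < e).
{ apply Hd; try lra. replace (t - t) with 0 by ring; rewrite Rabs_R0; lra. }
apply Rabs_lt_between' in K; simpl in K; specialize (Hm t Ht); lra.
Qed.

(** * Paths *)

(** The retraction of the line onto the unit interval. It is needed because [cont_path] asks for
    continuity on all of R; absolute values make its continuity automatic. *)
Definition clamp (s : R) : R := (Rabs s - Rabs (s - 1) + 1) / 2.

Lemma clamp_le_0 (s : R) : s <= 0 -> clamp s = 0.
Proof. intros; unfold clamp; rewrite !Rabs_left1 by lra; lra. Qed.

Lemma clamp_ge_1 (s : R) : 1 <= s -> clamp s = 1.
Proof. intros; unfold clamp; rewrite !Rabs_pos_eq by lra; lra. Qed.

Lemma clamp_id (s : R) : 0 <= s <= 1 -> clamp s = s.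
Proof.
intros; unfold clamp; rewrite Rabs_pos_eq, Rabs_left1 by lra; lra.
Qed.

Lemma continuity_clamp : continuity clamp.
Proof. unfold clamp; intros s; reg. Qed.

Definition conn (P : pt -> Prop) (x y : pt) : Prop :=
  exists gam, cont_path gam /\ gam 0 = x /\ gam 1 = y /\
    forall t, 0 <= t <= 1 -> P (gam t).

Lemma cont_path_Ccts (gam : R -> C) : cont_path gam <-> forall t, Ccts gam t.
Proof.
split.
- intros [H1 H2] t; split; apply continuity_pt_filterlim; [apply H1 | apply H2].
- intros H; split; intros t; destruct (H t); apply continuity_pt_filterlim; assumption.
Qed.

Lemma conn_trans P x y z : conn P x y -> conn P y z -> conn P x z.
Proof.
intros (g & [g1 g2] & g0 & ge & gP) (h & [h1 h2] & h0 & he & hP).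
assert (kc1 : continuity (fun t => clamp (2 * t))).
{ apply (continuity_comp (fun t => 2 * t) clamp); [intros t; reg | apply continuity_clamp]. }
assert (kc2 : continuity (fun t => clamp (2 * t - 1))).
{ apply (continuity_comp (fun t => 2 * t - 1) clamp); [intros t; reg | apply continuity_clamp]. }
(* At every time one of the two clamped paths rests at [y], so the sum minus [y] follows the other
   one; continuity then needs no gluing. *)
exists (fun t => (fst (g (clamp (2 * t))) + fst (h (clamp (2 * t - 1))) - fst y,
                  snd (g (clamp (2 * t))) + snd (h (clamp (2 * t - 1))) - snd y)).
split; [|split; [|split]].
- split; simpl; (apply continuity_minus; [apply continuity_plus | apply continuity_const; now intros]).
  + apply (continuity_comp _ (fun t => fst (g t)) kc1 g1).
  + apply (continuity_comp _ (fun t => fst (h t)) kc2 h1).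
  + apply (continuity_comp _ (fun t => snd (g t)) kc1 g2).
  + apply (continuity_comp _ (fun t => snd (h t)) kc2 h2).
- rewrite !clamp_le_0 by lra; rewrite g0, h0; destruct x, y; simpl; f_equal; ring.
- rewrite !clamp_ge_1 by lra; rewrite ge, he; destruct z, y; simpl; f_equal; ring.
- intros t Ht; destruct (Rle_dec t (1 / 2)).
  + rewrite (clamp_le_0 (2 * t - 1)), clamp_id by lra; rewrite h0.
    replace (_, _) with (g (2 * t)); [apply gP; lra|].
    destruct (g (2 * t)), y; simpl; f_equal; ring.
  + rewrite (clamp_ge_1 (2 * t)), clamp_id by lra; rewrite ge.
    replace (_, _) with (h (2 * t - 1)); [apply hP; lra|].
    destruct (h (2 * t - 1)), y; simpl; f_equal; ring.
Qed.

Lemma conn_curve (P : pt -> Prop) (f : R -> C) (s t : R) :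
  (forall u, Rmin s t <= u <= Rmax s t -> Ccts f u) ->
  (forall u, Rmin s t <= u <= Rmax s t -> P (f u)) -> conn P (f s) (f t).
Proof.
intros Hc HP.
assert (K : forall u, Rmin s t <= s + clamp u * (t - s) <= Rmax s t).
{ intros u; assert (0 <= clamp u <= 1).
  { destruct (Rle_dec u 0); [rewrite clamp_le_0; lra|].
    destruct (Rle_dec 1 u); [rewrite clamp_ge_1; lra|]; rewrite clamp_id; lra. }
  unfold Rmin, Rmax; destruct (Rle_dec s t); nra. }
exists (fun u => f (s + clamp u * (t - s))).
split; [|split; [|split]].
- apply cont_path_Ccts; intros u.
  assert (E : continuous (fun u => s + clamp u * (t - s)) u).
  { apply cts_plus; [apply cts_const|]; apply cts_mult; [|apply cts_const].
    apply continuity_pt_filterlim, continuity_clamp. }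
  destruct (Hc _ (K u)) as [H1 H2].
  split; [apply (cts_comp (fun v => Re (f v))) | apply (cts_comp (fun v => Im (f v)))];
    assumption.
- rewrite clamp_le_0 by lra; f_equal; ring.
- rewrite clamp_ge_1 by lra; f_equal; ring.
- intros u _; apply HP, K.
Qed.

Lemma conn_sym P x y : conn P x y -> conn P y x.
Proof.
intros (g & Hg & g0 & g1 & gP); subst.
apply conn_curve; rewrite Rmin_right, Rmax_left by lra;
  [intros u _; now apply cont_path_Ccts | exact gP].
Qed.

Lemma conn_mono (P Q : pt -> Prop) x y :
  (forall z, P z -> Q z) -> conn P x y -> conn Q x y.
Proof. intros H (g & Hg & g0 & g1 & gP); exists g; do 3 (split; [assumption|]); auto. Qed.

Lemma conn_l (P : pt -> Prop) x y : conn P x y -> P x.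
Proof. intros (g & _ & <- & _ & H); apply H; lra. Qed.

(** * Sectors at a vertex of an arc triangle *)

Definition chordal (a b : C) (th : R) (x : C) : C :=
  ((x - b) * Cconj (x - a) * cis (- (2 * th)))%C.

Definition avoids (a b : C) (th : R) (x : C) : Prop := 0 < slit (chordal a b th x).

(** The tangent at [a] of the arc to [b], up to a positive factor: the chord turned by half the
    sweep. Its companion [arr] is the tangent at [b] pointing back along the arc. *)
Definition dep (a b : C) (th : R) : C := ((b - a) * cis (- (2 * th)))%C.

Definition arr (a b : C) (th : R) : C := ((a - b) * cis (2 * th))%C.

Definition off (a b c : C) (t1 t2 t3 : R) (x : C) : Prop :=
  avoids a b t1 x /\ avoids b c t2 x /\ avoids c a t3 x.

(** The corner angles are stored as halves: [2 * pa] is the counterclockwise angle at [a] from the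
    arc leaving for [b] to the arc coming from [c]. The record is invariant under cyclic rotation,
    so that work at one vertex or along one edge covers all of them. *)
Record simple (a b c : C) (t1 t2 t3 pa pb pc : R) : Prop := {
  simple_ab : a <> b;
  simple_bc : b <> c;
  simple_ca : c <> a;
  simple_t1 : - (PI / 2) < t1 < PI / 2;
  simple_t2 : - (PI / 2) < t2 < PI / 2;
  simple_t3 : - (PI / 2) < t3 < PI / 2;
  simple_disj_b : forall x, x <> b -> avoids a b t1 x \/ avoids b c t2 x;
  simple_disj_c : forall x, x <> c -> avoids b c t2 x \/ avoids c a t3 x;
  simple_disj_a : forall x, x <> a -> avoids c a t3 x \/ avoids a b t1 x;
  simple_pa : 0 < pa < PI;
  simple_pb : 0 < pb < PI;
  simple_pc : 0 < pc < PI;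
  simple_angle_a : exists l : R, 0 < l /\ arr c a t3 = (l * (dep a b t1 * cis (2 * pa)))%C;
  simple_angle_b : exists l : R, 0 < l /\ arr a b t1 = (l * (dep b c t2 * cis (2 * pb)))%C;
  simple_angle_c : exists l : R, 0 < l /\ arr b c t2 = (l * (dep c a t3 * cis (2 * pc)))%C
}.

Lemma simple_rot a b c t1 t2 t3 pa pb pc :
  simple a b c t1 t2 t3 pa pb pc -> simple b c a t2 t3 t1 pb pc pa.
Proof. intros []; constructor; assumption. Qed.

Lemma off_rot a b c t1 t2 t3 x : off a b c t1 t2 t3 x -> off b c a t2 t3 t1 x.
Proof. intros (? & ? & ?); repeat split; assumption. Qed.

(** A whole thin cone about the direction [e] must be joined to [x], so that curves merely tangent
    to [e] at [v] can be compared with one another. *)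
Definition reach (P : pt -> Prop) (v e x : C) : Prop :=
  exists d, 0 < d /\ forall (r : R) (f : C), 0 < r < d ->
    Rabs (Re f - Re e) < d -> Rabs (Im f - Im e) < d -> conn P (v + r * f)%C x.

Definition near (P : pt -> Prop) (v dir : C) (lo hi : R) (x : C) : Prop :=
  exists phi lam, lo < phi < hi /\ 0 < lam /\ reach P v (lam * (dir * cis phi))%C x.

Lemma reach_mono (P Q : pt -> Prop) v e x :
  (forall z, P z -> Q z) -> reach P v e x -> reach Q v e x.
Proof.
intros H (d & Hd & K); exists d; split; [exact Hd|]; intros; eapply conn_mono; eauto.
Qed.

Lemma near_mono (P Q : pt -> Prop) v dir lo hi x :
  (forall z, P z -> Q z) -> near P v dir lo hi x -> near Q v dir lo hi x.
Proof.
intros H (p & l & Hp & Hl & K); exists p, l; do 2 (split; [assumption|]).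
eapply reach_mono; eauto.
Qed.

Lemma near_conn P v dir lo hi x y :
  near P v dir lo hi x -> conn P x y -> near P v dir lo hi y.
Proof.
intros (p & l & Hp & Hl & d & Hd & K) H; exists p, l; do 2 (split; [assumption|]).
exists d; split; [exact Hd|]; intros; eapply conn_trans; [apply K|]; assumption.
Qed.

Lemma cos_lt_1 (x : R) : - (2 * PI) < x < 2 * PI -> x <> 0 -> cos x < 1.
Proof.
intros Hx H0; replace x with (2 * (x / 2)) by field.
rewrite cos_2a_sin.
assert (sin (x / 2) <> 0).
{ destruct (Rdichotomy _ _ H0).
  - assert (0 < sin (- (x / 2))) by (apply sin_gt_0; lra).
    rewrite sin_neg in H1; lra.
  - assert (0 < sin (x / 2)) by (apply sin_gt_0; lra); lra. }
nra.
Qed.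

Lemma convex_between (lo hi x y t : R) :
  lo < x < hi -> lo < y < hi -> 0 <= t <= 1 -> lo < x + t * (y - x) < hi.
Proof.
intros Hx Hy Ht; destruct (Rle_dec x y).
- assert (0 <= t * (y - x)) by (apply Rmult_le_pos; lra).
  assert (0 <= (1 - t) * (y - x)) by (apply Rmult_le_pos; lra); lra.
- assert (0 <= t * (x - y)) by (apply Rmult_le_pos; lra).
  assert (0 <= (1 - t) * (x - y)) by (apply Rmult_le_pos; lra); lra.
Qed.

Lemma Cmod_sqr_pos (z : C) : z <> 0%C -> 0 < Cmod z ^ 2.
Proof. intros H; apply Cmod_gt_0 in H; apply pow_lt, H. Qed.

Section Vertex.
Variables (a b c : C) (t1 t2 t3 pa pb pc : R).
Hypothesis S : simple a b c t1 t2 t3 pa pb pc.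
Let P := off a b c t1 t2 t3.
Let d1 := dep a b t1.

(* The values of [chordal] at [a + r f] for the two arcs ending at [a], divided by [r]. *)
Let k1 (r : R) (f : C) : C := ((r * f + (a - b)) * Cconj f * cis (- (2 * t1)))%C.
Let k3 (r : R) (f : C) : C := (f * Cconj (r * f + (a - c)) * cis (- (2 * t3)))%C.
Let k2 (r : R) (f : C) : C := chordal b c t2 (a + r * f)%C.

Lemma chordal_scaled_out (r : R) (f : C) : chordal a b t1 (a + r * f)%C = (r * k1 r f)%C.
Proof.
unfold chordal, k1; replace (a + r * f - a)%C with (r * f)%C by ring.
rewrite Cmult_conj, conj_RtoC; ring.
Qed.

Lemma chordal_scaled_in (r : R) (f : C) : chordal c a t3 (a + r * f)%C = (r * k3 r f)%C.
Proof.
unfold chordal, k3; replace (a + r * f - c)%C with (r * f + (a - c))%C by ring.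
ring.
Qed.

Lemma off_scaled (r : R) (f : C) :
  0 < r -> 0 < slit (k1 r f) -> 0 < slit (k2 r f) -> 0 < slit (k3 r f) ->
  P (a + r * f)%C.
Proof.
intros Hr H1 H2 H3; split; [|split]; unfold avoids.
- rewrite chordal_scaled_out, slit_scal by lra; apply Rmult_lt_0_compat; assumption.
- exact H2.
- rewrite chordal_scaled_in, slit_scal by lra; apply Rmult_lt_0_compat; assumption.
Qed.

Lemma dep_neq_0 : d1 <> 0%C.
Proof.
apply Cmult_neq_0; [apply Cminus_neq_0; generalize (simple_ab _ _ _ _ _ _ _ _ _ S); congruence|].
apply cis_neq_0.
Qed.

(** The point [a] is on the arc from [a] to [b], which meets the arc from [b] to [c] only at [b]. *)
Lemma avoids_opposite : avoids b c t2 a.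
Proof.
destruct (simple_disj_b _ _ _ _ _ _ _ _ _ S a (simple_ab _ _ _ _ _ _ _ _ _ S)); [|assumption].
exfalso; revert H; unfold avoids.
replace (chordal a b t1 a) with (RtoC 0).
- unfold slit; rewrite Cmod_0; simpl; lra.
- unfold chordal; replace (a - a)%C with (RtoC 0) by ring; rewrite conj_RtoC; ring.
Qed.

Lemma slit_scaled_opposite (f : C) : 0 < slit (k2 0 f).
Proof.
unfold k2; replace (a + 0 * f)%C with a by ring; apply avoids_opposite.
Qed.

(** At radius zero the arc is replaced by its tangent ray: up to a positive factor only the angle
    [phi] from that ray matters, and the value is on the slit just when [phi] is a multiple of a
    full turn. *)
Lemma initial_scaled_chordal_out (lam phi : R) :
  k1 0 (lam * (d1 * cis phi))%C = ((lam * Cmod d1 ^ 2)%R * - cis (- phi))%C.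
Proof.
unfold k1; rewrite !Cmult_conj, conj_RtoC, <- cis_opp, RtoC_mult, <- mult_conj.
unfold d1, dep; ring.
Qed.

Lemma initial_scaled_chordal_in (lam phi : R) : exists l, 0 < l /\
  k3 0 (lam * (d1 * cis phi))%C = ((lam * l * Cmod d1 ^ 2)%R * - cis (phi - 2 * pa))%C.
Proof.
destruct (simple_angle_a _ _ _ _ _ _ _ _ _ S) as (l & Hl & E).
exists l; split; [exact Hl|].
replace (k3 0 (lam * (d1 * cis phi)))%C
  with (- (lam * (d1 * cis phi) * Cconj (arr c a t3)))%C.
- rewrite E; fold d1; rewrite !Cmult_conj, conj_RtoC, <- cis_opp, !RtoC_mult, <- mult_conj.
  replace (phi - 2 * pa) with (phi + - (2 * pa)) by ring.
  rewrite cis_plus; ring.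
- unfold k3, arr; rewrite Cmult_conj, <- cis_opp.
  replace (0 * (lam * (d1 * cis phi)) + (a - c))%C with (- (c - a))%C by ring.
  rewrite Copp_conj; ring.
Qed.

Lemma slit_scaled_out (lam phi : R) : 0 < lam -> 0 < phi < 2 * PI ->
  0 < slit (k1 0 (lam * (d1 * cis phi))%C).
Proof.
intros Hl Hp; generalize (Cmod_sqr_pos _ dep_neq_0); intros Hd.
assert (0 < lam * Cmod d1 ^ 2) by (apply Rmult_lt_0_compat; assumption).
rewrite initial_scaled_chordal_out, slit_scal, slit_opp_cis, cos_neg by lra.
apply Rmult_lt_0_compat; [assumption|].
generalize (cos_lt_1 phi); lra.
Qed.

Lemma slit_scaled_in (lam phi : R) : 0 < lam -> 0 < phi < 2 * PI -> phi <> 2 * pa ->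
  0 < slit (k3 0 (lam * (d1 * cis phi))%C).
Proof.
intros Hl Hp Hn; generalize (Cmod_sqr_pos _ dep_neq_0); intros Hd.
destruct (initial_scaled_chordal_in lam phi) as (l & Hl0 & ->).
assert (0 < lam * l * Cmod d1 ^ 2) by (apply Rmult_lt_0_compat; [apply Rmult_lt_0_compat|]; assumption).
rewrite slit_scal, slit_opp_cis by lra.
apply Rmult_lt_0_compat; [assumption|].
generalize (simple_pa _ _ _ _ _ _ _ _ _ S) (cos_lt_1 (phi - 2 * pa)); lra.
Qed.

Definition free_dir (phi : R) : Prop := 0 < phi < 2 * PI /\ phi <> 2 * pa.

(** Around radius zero and direction [e] there is a box where all three rescaled functions stay off
    the slit. The box is convex, so radius and direction can be interpolated linearly. *)
Lemma cone_conn (lam phi : R) : 0 < lam -> free_dir phi ->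
  exists d, 0 < d /\ forall (r r' : R) (f f' : C), 0 < r < d -> 0 < r' < d ->
    Rabs (Re f - Re (lam * (d1 * cis phi))%C) < d ->
    Rabs (Im f - Im (lam * (d1 * cis phi))%C) < d ->
    Rabs (Re f' - Re (lam * (d1 * cis phi))%C) < d ->
    Rabs (Im f' - Im (lam * (d1 * cis phi))%C) < d ->
    conn P (a + r * f)%C (a + r' * f')%C.
Proof.
intros Hl [Hp Hn]; set (e := (lam * (d1 * cis phi))%C).
destruct (continuous_pos (fun u : R * (R * R) => slit (k1 (fst u) (fst (snd u), snd (snd u)))) (0, e))
  as [e1 H1].
{ unfold k1; cts. }
{ change (0 < slit (k1 0 e)); apply slit_scaled_out; assumption. }
destruct (continuous_pos (fun u : R * (R * R) => slit (k2 (fst u) (fst (snd u), snd (snd u)))) (0, e))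
  as [e2 H2].
{ unfold k2, chordal; cts. }
{ apply slit_scaled_opposite. }
destruct (continuous_pos (fun u : R * (R * R) => slit (k3 (fst u) (fst (snd u), snd (snd u)))) (0, e))
  as [e3 H3].
{ unfold k3; cts. }
{ change (0 < slit (k3 0 e)); apply slit_scaled_in; assumption. }
set (d := Rmin e1 (Rmin e2 e3)).
assert (D1 : d <= e1) by apply Rmin_l.
assert (D2 : d <= e2) by (eapply Rle_trans; [apply Rmin_r | apply Rmin_l]).
assert (D3 : d <= e3) by (eapply Rle_trans; [apply Rmin_r | apply Rmin_r]).
assert (D : 0 < d).
{ unfold d; repeat apply Rmin_glb_lt; apply cond_pos. }
exists d; split; [exact D|]; intros r r' f f' Hr Hr' F1 F2 F1' F2'.
apply Rabs_lt_between' in F1, F2, F1', F2'.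
set (g := fun t : R => (a + (r + t * (r' - r))%R * (f + t * (f' - f)))%C).
replace (a + r * f)%C with (g 0)
  by (unfold g; replace (r + 0 * (r' - r)) with r by ring; ring).
replace (a + r' * f')%C with (g 1)
  by (unfold g; replace (r + 1 * (r' - r)) with r' by ring; ring).
apply (conn_curve P g); rewrite Rmin_left, Rmax_right by lra; intros t Ht.
{ unfold g; cts. }
assert (R0 : 0 < r + t * (r' - r) < d) by (apply convex_between; assumption).
assert (B : forall dd : posreal, d <= dd ->
  ball ((0, e) : R * (R * R)) dd ((r + t * (r' - r), (f + t * (f' - f))%C) : R * (R * R))).
{ intros dd Hdd; split; [|split]; apply Rabs_lt_between'; simpl fst; simpl snd.
  - lra.
  - change (Re e - dd < Re (f + t * (f' - f))%C < Re e + dd).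
    rewrite Re_plus, Re_scal, Re_minus; apply convex_between; lra.
  - change (Im e - dd < Im (f + t * (f' - f))%C < Im e + dd).
    rewrite Im_plus, Im_scal, Im_minus; apply convex_between; lra. }
apply off_scaled; [lra | | |].
- exact (H1 _ (B e1 D1)).
- exact (H2 _ (B e2 D2)).
- exact (H3 _ (B e3 D3)).
Qed.

Lemma reach_curve (lam phi : R) (f : R -> C) : 0 < lam -> free_dir phi ->
  Ccts f 0 -> f 0 = (lam * (d1 * cis phi))%C ->
  exists t0, 0 < t0 /\ forall t : R, 0 < t < t0 ->
    reach P a (lam * (d1 * cis phi))%C (a + t * f t)%C.
Proof.
intros Hl Hp [C1 C2] E.
destruct (cone_conn lam phi Hl Hp) as (d & Hd & K); rewrite <- E in K |- *.
destruct (C1 (fun y => Rabs (y - Re (f 0)) < d)) as [e1 H1].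
{ exists (mkposreal _ Hd); intros y Hy; exact Hy. }
destruct (C2 (fun y => Rabs (y - Im (f 0)) < d)) as [e2 H2].
{ exists (mkposreal _ Hd); intros y Hy; exact Hy. }
exists (Rmin d (Rmin e1 e2)); split.
{ repeat apply Rmin_glb_lt; try apply cond_pos; exact Hd. }
intros t [Ht0 Ht]; apply Rmin_Rgt_l in Ht; destruct Ht as [Ht1 Ht].
apply Rmin_Rgt_l in Ht; destruct Ht as [Ht2 Ht3].
exists d; split; [exact Hd|]; intros r g Hr G1 G2.
apply K; try assumption; [lra | |].
- apply H1; change (Rabs (t - 0) < e1); rewrite Rabs_pos_eq; lra.
- apply H2; change (Rabs (t - 0) < e2); rewrite Rabs_pos_eq; lra.
Qed.

Lemma near_curve (lam phi lo hi : R) (f : R -> C) : 0 < lam -> free_dir phi ->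
  lo < phi < hi -> Ccts f 0 -> f 0 = (lam * (d1 * cis phi))%C ->
  exists t0, 0 < t0 /\ forall t : R, 0 < t < t0 -> near P a d1 lo hi (a + t * f t)%C.
Proof.
intros Hl Hf Hp Hc E; destruct (reach_curve lam phi f Hl Hf Hc E) as (t0 & H0 & H).
exists t0; split; [exact H0|]; intros t Ht; exists phi, lam; auto.
Qed.

(** Descend to a common small radius and turn the direction from one to the other within the sector;
    [tube] gives a radius that works for all directions on the way. *)
Lemma near_near (lo hi : R) (x y : C) :
  (forall phi, lo < phi < hi -> free_dir phi) ->
  near P a d1 lo hi x -> near P a d1 lo hi y -> conn P x y.
Proof.
intros Hs (p & l & Hp & Hl & dx & Hdx & Kx) (q & m & Hq & Hm & dy & Hdy & Ky).
set (f := fun t : R => ((l + t * (m - l))%R * (d1 * cis (p + t * (q - p))))%C).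
assert (Hf : forall t, 0 <= t <= 1 -> 0 < l + t * (m - l) /\ free_dir (p + t * (q - p))).
{ intros t Ht; split; [|apply Hs, convex_between; assumption].
  apply (convex_between 0 (Rmax l m + 1)); try assumption;
    generalize (Rmax_l l m) (Rmax_r l m); lra. }
destruct (tube (fun u => slit (k1 (snd u) (f (fst u)))) 0 1 0) as (e1 & E1 & H1).
{ intros t _; unfold k1, f; cts. }
{ intros t Ht; destruct (Hf t Ht) as [? []]; apply slit_scaled_out; assumption. }
destruct (tube (fun u => slit (k2 (snd u) (f (fst u)))) 0 1 0) as (e2 & E2 & H2).
{ intros t _; unfold k2, chordal, f; cts. }
{ intros t Ht; apply slit_scaled_opposite. }
destruct (tube (fun u => slit (k3 (snd u) (f (fst u)))) 0 1 0) as (e3 & E3 & H3).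
{ intros t _; unfold k3, f; cts. }
{ intros t Ht; destruct (Hf t Ht) as [? []]; apply slit_scaled_in; assumption. }
assert (exists r, 0 < r /\ r < dx /\ r < dy /\ r < e1 /\ r < e2 /\ r < e3)
  as (r & r0 & rx & ry & r1 & r2 & r3).
{ set (m0 := Rmin dx (Rmin dy (Rmin e1 (Rmin e2 e3)))).
  assert (M : 0 < m0) by (unfold m0; repeat apply Rmin_glb_lt; assumption).
  assert (N : m0 / 2 < m0) by lra.
  unfold m0 in N at 2; exists (m0 / 2).
  repeat (apply Rmin_Rgt_l in N; destruct N as [? N]); repeat split; lra. }
apply conn_trans with (a + r * f 0)%C.
{ apply conn_sym, Kx; [lra | |]; unfold f;
    replace (l + 0 * (m - l)) with l by ring; replace (p + 0 * (q - p)) with p by ring;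
    rewrite Rminus_diag, Rabs_R0; assumption. }
apply conn_trans with (a + r * f 1)%C.
2: { apply Ky; [lra | |]; unfold f;
    replace (l + 1 * (m - l)) with m by ring; replace (p + 1 * (q - p)) with q by ring;
    rewrite Rminus_diag, Rabs_R0; assumption. }
apply (conn_curve P (fun t => a + r * f t)%C); rewrite Rmin_left, Rmax_right by lra;
  intros t Ht.
{ unfold f; cts. }
assert (R0 : forall e, r < e -> Rabs (r - 0) < e).
{ intros; rewrite Rminus_0_r, Rabs_pos_eq; lra. }
apply off_scaled; [assumption | | |].
- exact (H1 t r Ht (R0 _ r1)).
- exact (H2 t r Ht (R0 _ r2)).
- exact (H3 t r Ht (R0 _ r3)).
Qed.

End Vertex.

(** * Sliding along an arc *)

Section ArcPoint.
Variables a b : C.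

(* Rational parametrization of the arc: [s = 0] is [a], [s = 1] is [b]. *)
Definition arc_den (v s : R) : C := ((1 - s)%R * cis v + s * cis (- v))%C.

Definition arc_point (v s : R) : C :=
  (((1 - s)%R * cis v * a + s * cis (- v) * b) / arc_den v s)%C.

Lemma arc_den_neq_0 (v s : R) : - (PI / 2) < v < PI / 2 -> arc_den v s <> 0%C.
Proof.
intros Hv E; assert (H : Re (arc_den v s) = 0) by (rewrite E; reflexivity).
unfold arc_den in H; rewrite Re_plus, !Re_scal in H; unfold cis, Re in H; simpl in H.
rewrite cos_neg in H; generalize (cos_gt_0 v); lra.
Qed.

Lemma arc_point_a (v s : R) : - (PI / 2) < v < PI / 2 ->
  arc_point v s = (a + s * (cis (- v) * (b - a) / arc_den v s))%C.
Proof.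
intros Hv; generalize (arc_den_neq_0 v s Hv); intros H.
unfold arc_point; field_simplify_eq; [|exact H].
unfold arc_den; rewrite RtoC_minus; ring.
Qed.

Lemma arc_point_b (v s : R) : - (PI / 2) < v < PI / 2 ->
  arc_point v s = (b + (1 - s)%R * (cis v * (a - b) / arc_den v s))%C.
Proof.
intros Hv; generalize (arc_den_neq_0 v s Hv); intros H.
unfold arc_point; field_simplify_eq; [|exact H].
unfold arc_den; rewrite RtoC_minus; ring.
Qed.

Lemma arc_point_neq_a (v s : R) : - (PI / 2) < v < PI / 2 -> a <> b -> s <> 0 ->
  arc_point v s <> a.
Proof.
intros Hv Hab Hs E; rewrite arc_point_a in E by exact Hv.
assert (K : (s * (cis (- v) * (b - a) / arc_den v s))%C = 0%C).
{ replace (s * (cis (- v) * (b - a) / arc_den v s))%C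
    with (a + s * (cis (- v) * (b - a) / arc_den v s) - a)%C by ring.
  rewrite E; ring. }
revert K; apply Cmult_neq_0; [now apply RtoC_neq_0|].
apply Cmult_neq_0; [apply Cmult_neq_0|].
- apply cis_neq_0.
- apply Cminus_neq_0; congruence.
- now apply Cinv_neq_0, arc_den_neq_0.
Qed.

Lemma arc_point_neq_b (v s : R) : - (PI / 2) < v < PI / 2 -> a <> b -> s <> 1 ->
  arc_point v s <> b.
Proof.
intros Hv Hab Hs E; rewrite arc_point_b in E by exact Hv.
assert (K : ((1 - s)%R * (cis v * (a - b) / arc_den v s))%C = 0%C).
{ replace ((1 - s)%R * (cis v * (a - b) / arc_den v s))%C
    with (b + (1 - s)%R * (cis v * (a - b) / arc_den v s) - b)%C by ring.
  rewrite E; ring. }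
revert K; apply Cmult_neq_0; [apply RtoC_neq_0; lra|].
apply Cmult_neq_0; [apply Cmult_neq_0|].
- apply cis_neq_0.
- apply Cminus_neq_0; congruence.
- now apply Cinv_neq_0, arc_den_neq_0.
Qed.

(** As [v] varies, the arcs with ends [a] and [b] form a pencil, and on each of them the argument of
    [chordal] is constant for [0 < s < 1]. Away from the ends the arc [v] can thus meet the arc [th]
    only if [v - th] is a multiple of [PI]. *)
Lemma chordal_arc_point (th v s : R) : - (PI / 2) < v < PI / 2 ->
  chordal a b th (arc_point v s) =
  ((s * (1 - s) * (Cmod (b - a) / Cmod (arc_den v s)) ^ 2)%R * - cis (2 * (v - th)))%C.
Proof.
intros Hv; generalize (arc_den_neq_0 v s Hv); intros H.
rewrite RtoC_mult, <- Cmod_div, <- mult_conj by exact H.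
unfold chordal; rewrite arc_point_b at 1 by exact Hv; rewrite arc_point_a at 1 by exact Hv.
replace (2 * (v - th)) with (v + v + - (2 * th)) by ring.
rewrite !cis_plus.
replace (b + (1 - s)%R * (cis v * (a - b) / arc_den v s) - b)%C
  with ((1 - s)%R * - cis v * ((b - a) / arc_den v s))%C by (field; exact H).
replace (a + s * (cis (- v) * (b - a) / arc_den v s) - a)%C
  with (s * cis (- v) * ((b - a) / arc_den v s))%C by (field; exact H).
rewrite !Cmult_conj, conj_RtoC, <- cis_opp, Ropp_involutive, RtoC_mult.
ring.
Qed.

Lemma arc_point_on (th s : R) : - (PI / 2) < th < PI / 2 -> 0 <= s <= 1 ->
  ~ avoids a b th (arc_point th s).
Proof.
intros Ht Hs; unfold avoids; rewrite chordal_arc_point by exact Ht.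
rewrite slit_scal.
- replace (2 * (th - th)) with 0 by ring; rewrite slit_opp_cis, cos_0; lra.
- apply Rmult_le_pos; [apply Rmult_le_pos; lra | apply pow2_ge_0].
Qed.

Lemma arc_point_avoids (th v s : R) : - (PI / 2) < v < PI / 2 -> a <> b -> 0 < s < 1 ->
  0 < Rabs (v - th) < PI -> avoids a b th (arc_point v s).
Proof.
intros Hv Hab Hs Hd; unfold avoids; rewrite chordal_arc_point by exact Hv.
assert (0 < s * (1 - s) * (Cmod (b - a) / Cmod (arc_den v s)) ^ 2).
{ apply Rmult_lt_0_compat; [apply Rmult_lt_0_compat; lra|].
  apply pow_lt, Rdiv_lt_0_compat; apply Cmod_gt_0.
  - apply Cminus_neq_0; congruence.
  - now apply arc_den_neq_0. }
rewrite slit_scal, slit_opp_cis by lra.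
apply Rmult_lt_0_compat; [assumption|].
assert (v - th <> 0) by (intros E; rewrite E, Rabs_R0 in Hd; lra).
destruct Hd as [_ Hd]; apply Rabs_def2 in Hd.
generalize (cos_lt_1 (2 * (v - th))); lra.
Qed.

End ArcPoint.

Section Slide.
Variables (a b c : C) (t1 t2 t3 pa pb pc : R).
Hypothesis S : simple a b c t1 t2 t3 pa pb pc.
Let P := off a b c t1 t2 t3.

(** [fa] and [fb] are the difference quotients of the arc [v] at its two ends. With them, [m2] and
    [m3] are the [chordal] functions of the two neighbouring arcs with their zeros at [b] and at [a]
    divided out. *)
Let fa (v s : R) : C := (cis (- v) * (b - a) / arc_den v s)%C.
Let fb (v s : R) : C := (cis v * (a - b) / arc_den v s)%C.
Let m2 (s v : R) : C :=
  ((arc_point a b v s - c) * Cconj (fb v s) * cis (- (2 * t2)))%C.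
Let m3 (s v : R) : C :=
  (fa v s * Cconj (arc_point a b v s - c) * cis (- (2 * t3)))%C.

Lemma cts_arc_den {U : UniformSpace} (v s : U -> R) (x : U) :
  continuous v x -> continuous s x -> Ccts (fun u => arc_den (v u) (s u)) x.
Proof. intros; unfold arc_den; cts; assumption. Qed.

Lemma cts_arc_point {U : UniformSpace} (v s : U -> R) (x : U) :
  continuous v x -> continuous s x -> - (PI / 2) < v x < PI / 2 ->
  Ccts (fun u => arc_point a b (v u) (s u)) x.
Proof.
intros Hv Hs H; unfold arc_point; cts; try assumption.
- now apply cts_arc_den.
- now apply arc_den_neq_0.
Qed.

Lemma cts_parallel_start {U : UniformSpace} (v s : U -> R) (x : U) :
  continuous v x -> continuous s x -> - (PI / 2) < v x < PI / 2 ->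
  Ccts (fun u => fa (v u) (s u)) x.
Proof.
intros Hv Hs H; unfold fa; cts; try assumption.
- now apply cts_arc_den.
- now apply arc_den_neq_0.
Qed.

Lemma cts_parallel_end {U : UniformSpace} (v s : U -> R) (x : U) :
  continuous v x -> continuous s x -> - (PI / 2) < v x < PI / 2 ->
  Ccts (fun u => fb (v u) (s u)) x.
Proof.
intros Hv Hs H; unfold fb; cts; try assumption.
- now apply cts_arc_den.
- now apply arc_den_neq_0.
Qed.

Lemma parallel_dir_start (v : R) : fa v 0 = ((b - a) * cis (- (2 * v)))%C.
Proof.
unfold fa, arc_den.
replace ((1 - 0)%R * cis v + 0 * cis (- v))%C with (cis v)
  by (rewrite RtoC_minus; ring).
replace (- (2 * v)) with (2 * - v) by ring; rewrite cis_2.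
generalize (cis_opp_l v) (cis_neq_0 v); intros E N.
apply (Cmult_cancel_r _ _ (cis v) N).
replace ((b - a) * (cis (- v) * cis (- v)) * cis v)%C
  with ((b - a) * cis (- v) * (cis (- v) * cis v))%C by ring.
rewrite E; field; exact N.
Qed.

Lemma parallel_dir_end (v : R) : fb v 1 = ((a - b) * cis (2 * v))%C.
Proof.
unfold fb, arc_den.
replace ((1 - 1)%R * cis v + 1 * cis (- v))%C with (cis (- v))
  by (rewrite RtoC_minus; ring).
rewrite cis_2; generalize (cis_opp_l v) (cis_neq_0 (- v)); intros E N.
apply (Cmult_cancel_r _ _ (cis (- v)) N).
replace ((a - b) * (cis v * cis v) * cis (- v))%C
  with ((a - b) * cis v * (cis (- v) * cis v))%C by ring.
rewrite E; field; exact N.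
Qed.

Lemma chordal_parallel_next (v s : R) : - (PI / 2) < v < PI / 2 ->
  chordal b c t2 (arc_point a b v s) = ((1 - s)%R * m2 s v)%C.
Proof.
intros Hv; unfold chordal, m2.
replace (arc_point a b v s - b)%C with ((1 - s)%R * fb v s)%C
  by (rewrite arc_point_b by exact Hv; fold (fb v s); ring).
rewrite Cmult_conj, conj_RtoC; ring.
Qed.

Lemma chordal_parallel_prev (v s : R) : - (PI / 2) < v < PI / 2 ->
  chordal c a t3 (arc_point a b v s) = (s * m3 s v)%C.
Proof.
intros Hv; unfold chordal, m3.
replace (arc_point a b v s - a)%C with (s * fa v s)%C
  by (rewrite arc_point_a by exact Hv; fold (fa v s); ring).
ring.
Qed.

Lemma arc_point_0 (v : R) : - (PI / 2) < v < PI / 2 -> arc_point a b v 0 = a.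
Proof. intros; rewrite arc_point_a by assumption; ring. Qed.

Lemma arc_point_1 (v : R) : - (PI / 2) < v < PI / 2 -> arc_point a b v 1 = b.
Proof. intros; rewrite arc_point_b, Rminus_diag by assumption; ring. Qed.

(** A corner angle strictly between zero and a full turn keeps the two tangents from pointing the
    same way. This gives positivity at the ends, where [chordal] itself vanishes. *)
Lemma slit_angle (d e : C) (l p : R) : d <> 0%C -> 0 < l -> 0 < p < PI ->
  e = (l * (d * cis (2 * p)))%C ->
  0 < slit (- (d * Cconj e))%C.
Proof.
intros Hd Hl Hp ->; rewrite !Cmult_conj, conj_RtoC, <- cis_opp.
replace (- (d * (l * (Cconj d * cis (- (2 * p))))))%C
  with ((l * Cmod d ^ 2)%R * - cis (- (2 * p)))%C.
- generalize (Cmod_sqr_pos d Hd); intros.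
  assert (0 < l * Cmod d ^ 2) by (apply Rmult_lt_0_compat; assumption).
  rewrite slit_scal, slit_opp_cis, cos_neg by lra.
  apply Rmult_lt_0_compat; [assumption|]; generalize (cos_lt_1 (2 * p)); lra.
- rewrite RtoC_mult, <- mult_conj; ring.
Qed.

(** For [s < 1] this is disjointness of the arcs [ab] and [bc] away from [b]; at [s = 1] the angle
    at [b] takes over. *)
Lemma slit_parallel_next (s : R) : 0 <= s <= 1 -> 0 < slit (m2 s t1).
Proof.
intros Hs; generalize (simple_t1 _ _ _ _ _ _ _ _ _ S); intros Ht.
destruct (Req_dec s 1) as [->|Hn].
- unfold m2; rewrite arc_point_1, parallel_dir_end by assumption.
  destruct (simple_angle_b _ _ _ _ _ _ _ _ _ S) as (l & Hl & E).
  fold (arr a b t1).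
  replace ((b - c) * Cconj (arr a b t1) * cis (- (2 * t2)))%C
    with (- (dep b c t2 * Cconj (arr a b t1)))%C by (unfold dep; ring).
  apply slit_angle with l pb; auto.
  + apply (dep_neq_0 _ _ _ _ _ _ _ _ _ (simple_rot _ _ _ _ _ _ _ _ _ S)).
  + apply (simple_pb _ _ _ _ _ _ _ _ _ S).
- destruct (simple_disj_b _ _ _ _ _ _ _ _ _ S (arc_point a b t1 s)) as [H|H].
  + apply arc_point_neq_b; auto; apply (simple_ab _ _ _ _ _ _ _ _ _ S).
  + exfalso; revert H; now apply arc_point_on.
  + unfold avoids in H; rewrite chordal_parallel_next, slit_scal in H by (assumption || lra).
    generalize (slit_ge_0 (m2 s t1)); intros; apply Rnot_le_lt; intros ?.
    replace (slit (m2 s t1)) with 0 in H; lra.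
Qed.

Lemma slit_parallel_prev (s : R) : 0 <= s <= 1 -> 0 < slit (m3 s t1).
Proof.
intros Hs; generalize (simple_t1 _ _ _ _ _ _ _ _ _ S); intros Ht.
destruct (Req_dec s 0) as [->|Hn].
- unfold m3; rewrite arc_point_0, parallel_dir_start by assumption.
  destruct (simple_angle_a _ _ _ _ _ _ _ _ _ S) as (l & Hl & E).
  fold (dep a b t1).
  replace (dep a b t1 * Cconj (a - c) * cis (- (2 * t3)))%C
    with (- (dep a b t1 * Cconj (arr c a t3)))%C
    by (unfold arr; rewrite Cmult_conj, <- cis_opp; replace (a - c)%C with (- (c - a))%C by ring;
        rewrite Copp_conj; ring).
  apply slit_angle with l pa; auto.
  + apply (dep_neq_0 _ _ _ _ _ _ _ _ _ S).
  + apply (simple_pa _ _ _ _ _ _ _ _ _ S).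
- destruct (simple_disj_a _ _ _ _ _ _ _ _ _ S (arc_point a b t1 s)) as [H|H].
  + apply arc_point_neq_a; auto; apply (simple_ab _ _ _ _ _ _ _ _ _ S).
  + unfold avoids in H; rewrite chordal_parallel_prev, slit_scal in H by (assumption || lra).
    generalize (slit_ge_0 (m3 s t1)); intros; apply Rnot_le_lt; intros ?.
    replace (slit (m3 s t1)) with 0 in H; lra.
  + exfalso; revert H; now apply arc_point_on.
Qed.

(** The rescaled functions of the neighbouring arcs are positive along the closed edge, so [tube]
    keeps them positive for all [v] close to [t1]. The edge itself is avoided since [v] differs from
    [t1]. *)
Lemma parallel_arc : exists d, 0 < d /\ d < PI / 2 /\
  forall v s, 0 < Rabs (v - t1) < d -> 0 < s < 1 ->
    - (PI / 2) < v < PI / 2 /\ P (arc_point a b v s).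
Proof.
generalize (simple_t1 _ _ _ _ _ _ _ _ _ S); intros Ht.
destruct (tube (fun u => slit (m2 (fst u) (snd u))) 0 1 t1) as (e1 & E1 & H1).
{ intros s _; apply cts_slit; unfold m2; cts.
  - apply cts_arc_point; [apply cts_snd | apply cts_fst | assumption].
  - apply cts_parallel_end; [apply cts_snd | apply cts_fst | assumption]. }
{ intros s Hs; now apply slit_parallel_next. }
destruct (tube (fun u => slit (m3 (fst u) (snd u))) 0 1 t1) as (e2 & E2 & H2).
{ intros s _; apply cts_slit; unfold m3; cts.
  - apply cts_parallel_start; [apply cts_snd | apply cts_fst | assumption].
  - apply cts_arc_point; [apply cts_snd | apply cts_fst | assumption]. }
{ intros s Hs; now apply slit_parallel_prev. }
set (d := Rmin (Rmin (PI / 2 - t1) (PI / 2 + t1)) (Rmin e1 e2)).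
assert (D1 : d <= PI / 2 - t1) by (eapply Rle_trans; apply Rmin_l).
assert (D2 : d <= PI / 2 + t1) by (eapply Rle_trans; [apply Rmin_l | apply Rmin_r]).
assert (D3 : d <= e1) by (eapply Rle_trans; [apply Rmin_r | apply Rmin_l]).
assert (D4 : d <= e2) by (eapply Rle_trans; [apply Rmin_r | apply Rmin_r]).
assert (D : 0 < d) by (unfold d; repeat apply Rmin_glb_lt; lra).
exists (d / 2); split; [lra|]; split; [lra|]; intros v s Hd Hs.
assert (Hv : - (PI / 2) < v < PI / 2).
{ destruct Hd as [_ Hd]; apply Rabs_def2 in Hd; lra. }
split; [exact Hv|]; split; [|split].
- apply arc_point_avoids; auto; [apply (simple_ab _ _ _ _ _ _ _ _ _ S) | lra].
- unfold avoids; rewrite chordal_parallel_next, slit_scal by (assumption || lra).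
  apply Rmult_lt_0_compat; [lra|]; apply (H1 s v); lra.
- unfold avoids; rewrite chordal_parallel_prev, slit_scal by (assumption || lra).
  apply Rmult_lt_0_compat; [lra|]; apply (H2 s v); lra.
Qed.

(** The arc [v] leaves [a] at angle [2 * (t1 - v)] from the edge to [b], and leaves [b] at angle
    [2 * pb - 2 * (t1 - v)] from the edge to [c], hence on the same side of the edge at both ends.
    The angles are prescribed through [cis] only, so that a representative inside the sector can be
    chosen. *)
Lemma slide_dir (v phia phib loa hia lob hib : R) :
  - (PI / 2) < v < PI / 2 ->
  (forall s, 0 < s < 1 -> P (arc_point a b v s)) ->
  free_dir pa phia -> free_dir pb phib ->
  loa < phia < hia -> lob < phib < hib ->
  cis phia = cis (2 * (t1 - v)) -> cis phib = cis (2 * pb + - (2 * (t1 - v))) ->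
  near P a (dep a b t1) loa hia (arc_point a b v (1 / 2)) /\
  near P b (dep b c t2) lob hib (arc_point a b v (1 / 2)).
Proof.
intros Hv HP Fa Fb Ia Ib Ea Eb.
assert (J : forall s, 0 < s < 1 -> conn P (arc_point a b v s) (arc_point a b v (1 / 2))).
{ intros s Hs; apply (conn_curve P (arc_point a b v)); intros u Hu.
  - apply (cts_arc_point (fun _ => v) (fun u => u)); [apply cts_const | apply cts_id | exact Hv].
  - apply HP; revert Hu; unfold Rmin, Rmax; destruct (Rle_dec s (1 / 2)); lra. }
split.
- destruct (near_curve _ _ _ _ _ _ _ _ _ S 1 phia loa hia (fa v)) as (s0 & H0 & H);
    try assumption; [lra | | |].
  + apply (cts_parallel_start (fun _ => v) (fun u => u)); [apply cts_const | apply cts_id | exact Hv].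
  + rewrite parallel_dir_start, Ea; unfold dep.
    replace (- (2 * v)) with (- (2 * t1) + 2 * (t1 - v)) by ring.
    rewrite cis_plus; ring.
  + set (s := Rmin s0 1 / 2).
    assert (0 < Rmin s0 1) by (apply Rmin_glb_lt; lra).
    generalize (Rmin_l s0 1) (Rmin_r s0 1); intros.
    apply near_conn with (arc_point a b v s); [|apply J; unfold s; lra].
    rewrite arc_point_a by exact Hv; apply (H s); unfold s; lra.
- destruct (simple_angle_b _ _ _ _ _ _ _ _ _ S) as (l & Hl & E).
  (* At [b] the arc is run backwards, as a curve issuing from the first vertex of the rotated
     triangle. *)
  destruct (near_curve _ _ _ _ _ _ _ _ _ (simple_rot _ _ _ _ _ _ _ _ _ S)
              l phib lob hib (fun s => fb v (1 - s))) as (s0 & H0 & H);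
    try assumption.
  + apply (cts_parallel_end (fun _ => v) (fun u => 1 - u)); [apply cts_const | | exact Hv].
    apply cts_minus; [apply cts_const | apply cts_id].
  + rewrite Rminus_0_r, parallel_dir_end, Eb, cis_plus.
    replace (l * (dep b c t2 * (cis (2 * pb) * cis (- (2 * (t1 - v))))))%C
      with (arr a b t1 * cis (- (2 * (t1 - v))))%C by (rewrite E; ring).
    unfold arr; replace (2 * v) with (2 * t1 + - (2 * (t1 - v))) by ring.
    rewrite cis_plus; ring.
  + set (s := Rmin s0 1 / 2).
    assert (0 < Rmin s0 1) by (apply Rmin_glb_lt; lra).
    generalize (Rmin_l s0 1) (Rmin_r s0 1); intros.
    apply near_conn with (arc_point a b v (1 - s)); [|apply J; unfold s; lra].
    apply near_mono with (off b c a t2 t3 t1).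
    { intros z Hz; apply off_rot, off_rot, Hz. }
    rewrite arc_point_b by exact Hv.
    replace (1 - (1 - s)) with s by ring; apply (H s); unfold s; lra.
Qed.

Lemma slide :
  (exists x, near P a (dep a b t1) 0 (2 * pa) x /\ near P b (dep b c t2) 0 (2 * pb) x) /\
  (exists x, near P a (dep a b t1) (2 * pa) (2 * PI) x /\
             near P b (dep b c t2) (2 * pb) (2 * PI) x).
Proof.
generalize (simple_pa _ _ _ _ _ _ _ _ _ S) (simple_pb _ _ _ _ _ _ _ _ _ S); intros Ha Hb.
destruct parallel_arc as (d & D & _ & H).
(* The angular offset [2 * w] has to fit into both sectors at [a] and both sectors at [b]. *)
assert (exists w, 0 < w /\ w < d /\ w < pa /\ w < pb /\ w < PI - pa /\ w < PI - pb)
  as (w & W0 & W1 & W2 & W3 & W4 & W5).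
{ set (m0 := Rmin d (Rmin pa (Rmin pb (Rmin (PI - pa) (PI - pb))))).
  assert (M : 0 < m0) by (unfold m0; repeat apply Rmin_glb_lt; lra).
  assert (N : m0 / 2 < m0) by lra.
  unfold m0 in N at 2; exists (m0 / 2).
  repeat (apply Rmin_Rgt_l in N; destruct N as [? N]); repeat split; lra. }
split.
- assert (A : 0 < Rabs (t1 - w - t1) < d).
  { replace (t1 - w - t1) with (- w) by ring; rewrite Rabs_Ropp, Rabs_pos_eq; lra. }
  exists (arc_point a b (t1 - w) (1 / 2)).
  apply slide_dir with (2 * w) (2 * pb - 2 * w); unfold free_dir; try lra.
  + apply (H (t1 - w) (1 / 2)); lra.
  + intros s Hs; now apply H.
  + f_equal; ring.
  + f_equal; ring.
- assert (A : 0 < Rabs (t1 + w - t1) < d).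
  { replace (t1 + w - t1) with w by ring; rewrite Rabs_pos_eq; lra. }
  exists (arc_point a b (t1 + w) (1 / 2)).
  apply slide_dir with (2 * PI - 2 * w) (2 * pb + 2 * w); unfold free_dir; try lra.
  + apply (H (t1 + w) (1 / 2)); lra.
  + intros s Hs; now apply H.
  + replace (2 * PI - 2 * w) with (2 * (t1 - (t1 + w)) + 2 * INR 1 * PI) by (simpl; ring).
    unfold cis; now rewrite cos_period, sin_period.
  + f_equal; ring.
Qed.

End Slide.

(** * The side function *)

Lemma polar (z : C) : exists t, - PI <= t <= PI /\ z = (Cmod z * cis t)%C.
Proof.
destruct (Req_dec (Cmod z) 0) as [H0|H0].
{ exists 0; split; [generalize PI_RGT_0; lra|].
  rewrite H0; rewrite (Cmod_eq_0 _ H0); ring. }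
assert (Hm : 0 < Cmod z) by (generalize (Cmod_ge_0 z); lra).
set (x := Re z / Cmod z); set (y := Im z / Cmod z).
assert (E : x * x + y * y = 1).
{ unfold x, y; generalize (Cmod2_alt z); intros K; field_simplify_eq; lra. }
assert (Hx : -1 <= x <= 1) by nra.
assert (Ez : z = (Cmod z * (x, y))%C).
{ apply C_eq; [rewrite Re_scal | rewrite Im_scal]; unfold x, y, Re, Im; simpl; field; exact H0. }
generalize (acos_bound x); intros B.
assert (Es : sin (acos x) = Rabs y).
{ rewrite sin_acos by exact Hx; rewrite <- sqrt_Rsqr_abs; f_equal; unfold Rsqr; lra. }
destruct (Rle_dec 0 y).
- exists (acos x); split; [lra|]; rewrite Ez at 1; unfold cis.
  rewrite cos_acos, Es, Rabs_pos_eq by assumption; reflexivity.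
- exists (- acos x); split; [lra|]; rewrite Ez at 1; unfold cis.
  rewrite cos_neg, sin_neg, cos_acos, Es, Rabs_left by (assumption || lra).
  now rewrite Ropp_involutive.
Qed.

Lemma real_of_sqr (z : C) (r : R) : 0 < r -> (z * z)%C = RtoC r -> Im z = 0 /\ Re z <> 0.
Proof.
intros Hr E.
assert (E1 : Re z * Re z - Im z * Im z = r) by (rewrite <- Re_mult, E; reflexivity).
assert (E2 : Re z * Im z + Im z * Re z = 0) by (rewrite <- Im_mult, E; reflexivity).
assert (Re z <> 0) by (intros K; rewrite K in E1; nra).
split; [|assumption].
assert (K : Re z * Im z = 0) by lra; apply Rmult_integral in K; tauto.
Qed.

Section Side.
Variables (a b c : C) (t1 t2 t3 : R).

(* Each factor is [sqrt ((x - b) / (x - a))] up to a positive factor, for the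
   branch of the square root that is cut exactly along the arc from [a] to [b];
   the radicands multiply to 1, so the product is real and changes sign across
   the curve. *)
Definition branch (w1 w2 w3 : C) : C :=
  (cis t1 * add_mod w1 * (cis t2 * add_mod w2) * (cis t3 * add_mod w3))%C.

Definition side (x : C) : R :=
  Re (branch (chordal a b t1 x) (chordal b c t2 x) (chordal c a t3 x)).

Lemma branch_scal (r1 r2 r3 : R) (w1 w2 w3 : C) : 0 <= r1 -> 0 <= r2 -> 0 <= r3 ->
  branch (r1 * w1) (r2 * w2) (r3 * w3) = ((r1 * r2 * r3)%R * branch w1 w2 w3)%C.
Proof.
intros; unfold branch; rewrite !add_mod_scal, !RtoC_mult by assumption; ring.
Qed.

Lemma Ccts_branch {U : UniformSpace} (f g h : U -> C) (x : U) :
  Ccts f x -> Ccts g x -> Ccts h x -> Ccts (fun u => branch (f u) (g u) (h u)) x.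
Proof. intros; unfold branch; cts; assumption. Qed.

Lemma branch_sqr (w1 w2 w3 : C) :
  (branch w1 w2 w3 * branch w1 w2 w3)%C =
  ((8 * slit w1 * slit w2 * slit w3)%R *
   ((cis (2 * t1) * w1) * (cis (2 * t2) * w2) * (cis (2 * t3) * w3)))%C.
Proof.
unfold branch.
replace (cis t1 * add_mod w1 * (cis t2 * add_mod w2) * (cis t3 * add_mod w3) *
  (cis t1 * add_mod w1 * (cis t2 * add_mod w2) * (cis t3 * add_mod w3)))%C
  with ((cis t1 * cis t1) * (cis t2 * cis t2) * (cis t3 * cis t3) *
        (add_mod w1 * add_mod w1) * (add_mod w2 * add_mod w2) * (add_mod w3 * add_mod w3))%C by ring.
rewrite !add_mod_sqr, !cis_2, !RtoC_mult.
replace (RtoC 8) with (2 * 2 * 2)%C by (rewrite <- !RtoC_mult; f_equal; ring); ring.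
Qed.

Lemma cis_chordal (p q x : C) (t : R) :
  (cis (2 * t) * chordal p q t x)%C = ((x - q) * Cconj (x - p))%C.
Proof.
unfold chordal.
replace (cis (2 * t) * ((x - q) * Cconj (x - p) * cis (- (2 * t))))%C
  with ((x - q) * Cconj (x - p) * (cis (2 * t) * cis (- (2 * t))))%C by ring.
rewrite cis_opp_r; ring.
Qed.

Lemma avoids_neq (p q x : C) (t : R) : avoids p q t x -> x <> p /\ x <> q.
Proof.
unfold avoids; intros H.
assert (K : chordal p q t x <> 0%C).
{ intros E; rewrite E in H; unfold slit in H; rewrite Cmod_0 in H; simpl in H; lra. }
split; intros E; apply K; rewrite E; unfold chordal.
- replace (p - p)%C with (RtoC 0) by ring; rewrite conj_RtoC; ring.
- ring.
Qed.

(** Because [chordal] has a conjugate in place of a quotient, the radicands multiply here to the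
    product of the squared distances to [a], [b] and [c], a positive real. A number with positive
    square is real and nonzero. *)
Lemma side_real (x : C) : off a b c t1 t2 t3 x ->
  Im (branch (chordal a b t1 x) (chordal b c t2 x) (chordal c a t3 x)) = 0 /\ side x <> 0.
Proof.
intros (H1 & H2 & H3).
destruct (avoids_neq _ _ _ _ H1) as [Xa Xb]; destruct (avoids_neq _ _ _ _ H2) as [_ Xc].
apply (real_of_sqr _ (8 * slit (chordal a b t1 x) * slit (chordal b c t2 x) *
  slit (chordal c a t3 x) * (Cmod (x - a) ^ 2 * Cmod (x - b) ^ 2 * Cmod (x - c) ^ 2))).
- unfold avoids in *.
  repeat apply Rmult_lt_0_compat; try assumption; try lra;
    apply Cmod_gt_0, Cminus_neq_0; assumption.
- rewrite branch_sqr, !cis_chordal.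
  rewrite !RtoC_mult, <- !mult_conj; ring.
Qed.

Lemma cts_side {U : UniformSpace} (f : U -> C) (u : U) :
  Ccts f u -> continuous (fun u => side (f u)) u.
Proof.
intros H; unfold side; apply cts_Re; apply Ccts_branch; unfold chordal; cts; assumption.
Qed.

Lemma conn_side (x y : C) : conn (off a b c t1 t2 t3) x y -> 0 < side x * side y.
Proof.
intros (g & Hg & <- & <- & HP).
apply Rnot_le_lt; intros H.
destruct (IVT_cor (fun t => side (g t)) 0 1) as (z & Hz & E).
- intros t; apply continuity_pt_filterlim; apply (cts_side g).
  now apply cont_path_Ccts.
- lra.
- exact H.
- exact (proj2 (side_real _ (HP z Hz)) E).
Qed.

(** At infinity the square root contributes the direction [cis (- t)], which cancels the prefactor
    [cis t]. Each rescaled factor tends to [2 * cos t], positive for the allowed [t]. *)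
Lemma side_far : - (PI / 2) < t1 < PI / 2 -> - (PI / 2) < t2 < PI / 2 ->
  - (PI / 2) < t3 < PI / 2 ->
  exists M : R, forall x : C, M < Cmod x ^ 2 -> 0 < side x.
Proof.
intros H1 H2 H3.
(* [chordal] divided by the squared modulus of [x], in terms of the direction [th] and the inverse
   modulus [r]. Infinity becomes the compact slice [r = 0]. *)
set (j := fun (p q : C) (t th r : R) =>
  ((cis th - r * q) * Cconj (cis th - r * p) * cis (- (2 * t)))%C).
destruct (tube (fun u => Re (branch (j a b t1 (fst u) (snd u))
  (j b c t2 (fst u) (snd u)) (j c a t3 (fst u) (snd u)))) (- PI) PI 0) as (d & D & H).
{ intros th _; apply cts_Re; apply Ccts_branch; unfold j; cts. }
{ intros th _; simpl fst; simpl snd.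
  assert (J : forall p q t, (cis t * add_mod (j p q t th 0))%C = RtoC (2 * cos t)).
  { intros p q t; unfold j.
    replace (cis th - 0 * q)%C with (cis th) by ring.
    replace (cis th - 0 * p)%C with (cis th) by ring.
    rewrite mult_conj, Cmod_cis.
    replace (1 ^ 2) with 1 by ring; rewrite Cmult_1_l.
    unfold add_mod; rewrite Cmod_cis.
    replace (- (2 * t)) with (- t + - t) by ring; rewrite cis_plus.
    replace (cis t * (cis (- t) * cis (- t) + 1))%C
      with ((cis t * cis (- t)) * cis (- t) + cis t)%C by ring.
    rewrite cis_opp_r; apply C_eq; unfold cis, Re, Im; simpl;
      rewrite ?cos_neg, ?sin_neg; ring. }
  unfold branch; rewrite !J, <- !RtoC_mult, Re_RtoC.
  repeat apply Rmult_lt_0_compat; try lra; apply cos_gt_0; lra. }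
exists ((/ d) ^ 2); intros x Hx.
assert (Hd : 0 < / d) by now apply Rinv_0_lt_compat.
assert (Hm : / d < Cmod x) by (generalize (Cmod_ge_0 x); intros; nra).
destruct (polar x) as (th & Hth & E).
set (m := Cmod x) in *.
assert (J : forall p q t, chordal p q t x = ((m * m)%R * j p q t th (/ m)%R)%C).
{ intros p q t; unfold chordal, j; rewrite E.
  assert (N : RtoC m <> 0%C) by (apply RtoC_neq_0; lra).
  replace (m * cis th - q)%C with (m * (cis th - (/ m)%R * q))%C
    by (rewrite RtoC_inv by lra; field; exact N).
  replace (m * cis th - p)%C with (m * (cis th - (/ m)%R * p))%C
    by (rewrite RtoC_inv by lra; field; exact N).
  rewrite Cmult_conj, conj_RtoC, RtoC_mult; ring. }
unfold side; rewrite !J, branch_scal, Re_scal by nra.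
apply Rmult_lt_0_compat.
- repeat apply Rmult_lt_0_compat; lra.
- apply (H th (/ m) Hth).
  rewrite Rminus_0_r, Rabs_pos_eq.
  + rewrite <- (Rinv_inv d); apply Rinv_lt_contravar; [nra|exact Hm].
  + left; apply Rinv_0_lt_compat; lra.
Qed.

End Side.

(** * The sign change of [side] at a vertex *)

(** Near a vertex the factors of the two adjacent arcs become [1 - cis (- phi)] and
    [1 - cis (phi - 2 * pa)]. Their product has the fixed direction [cis (- pa)], and all dependence
    on [phi] sits in two real sines. *)
Lemma cis_half (u w : R) :
  ((1 - cis (- (2 * u))) * (1 - cis (2 * w)))%C =
  ((4 * sin u * sin w)%R * cis (w - u))%C.
Proof.
assert (A : (1 - cis (- (2 * u)))%C = ((2 * sin u)%R * (Ci * cis (- u)))%C).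
{ apply C_eq; unfold cis, Re, Im; simpl; rewrite ?cos_neg, ?sin_neg, ?cos_2a_sin, ?sin_2a; ring. }
assert (B : (1 - cis (2 * w))%C = ((2 * sin w)%R * (- Ci * cis w))%C).
{ apply C_eq; unfold cis, Re, Im; simpl; rewrite ?cos_2a_sin, ?sin_2a; ring. }
rewrite A, B; replace (w - u) with (- u + w) by ring; rewrite cis_plus.
replace (4 * sin u * sin w) with (2 * sin u * (2 * sin w)) by ring.
rewrite (RtoC_mult (2 * sin u)).
replace ((2 * sin u)%R * (Ci * cis (- u)) * ((2 * sin w)%R * (- Ci * cis w)))%C
  with (- (Ci * Ci) * ((2 * sin u)%R * (2 * sin w)%R * (cis (- u) * cis w)))%C by ring.
replace (Ci * Ci)%C with (- (1))%C by (apply C_eq; unfold Re, Im; simpl; ring).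
ring.
Qed.

Section Jump.
Variables (a b c : C) (t1 t2 t3 pa pb pc : R).
Hypothesis S : simple a b c t1 t2 t3 pa pb pc.
Let P := off a b c t1 t2 t3.
Let d1 := dep a b t1.
Let k1 (r : R) (f : C) : C := ((r * f + (a - b)) * Cconj f * cis (- (2 * t1)))%C.
Let k3 (r : R) (f : C) : C := (f * Cconj (r * f + (a - c)) * cis (- (2 * t3)))%C.
Let k2 (r : R) (f : C) : C := chordal b c t2 (a + r * f)%C.
(** The part of the limit of [branch] at [a] that does not depend on the direction of approach. *)
Let z : C := (cis t1 * cis t2 * cis t3 * add_mod (chordal b c t2 a) * cis (- pa))%C.

Lemma side_scaled (r : R) (f : C) : 0 <= r ->
  side a b c t1 t2 t3 (a + r * f)%C =
  r ^ 2 * Re (branch t1 t2 t3 (k1 r f) (k2 r f) (k3 r f)).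
Proof.
intros Hr; unfold side; rewrite chordal_scaled_out, chordal_scaled_in; fold (k1 r f) (k3 r f) (k2 r f).
replace (k2 r f) with (1 * k2 r f)%C at 1 by ring.
rewrite branch_scal, Re_scal by lra; ring.
Qed.

(** After squaring, the angle condition at [a] cancels every turn and leaves a positive real. *)
Lemma jump_factor_real : Im z = 0 /\ Re z <> 0.
Proof.
destruct (simple_angle_a _ _ _ _ _ _ _ _ _ S) as (l & Hl & E).
assert (Hab : (a - b)%C <> 0%C).
{ apply Cminus_neq_0, (simple_ab _ _ _ _ _ _ _ _ _ S). }
assert (A : avoids b c t2 a) by exact (avoids_opposite _ _ _ _ _ _ _ _ _ S).
unfold avoids in A; generalize (Cmod_sqr_pos _ Hab); intros M.
apply (real_of_sqr _ (2 * slit (chordal b c t2 a) * (l * Cmod (a - b) ^ 2))).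
{ repeat apply Rmult_lt_0_compat; try assumption; try lra; now apply Cmod_gt_0. }
unfold z.
replace (cis t1 * cis t2 * cis t3 * add_mod (chordal b c t2 a) * cis (- pa) *
  (cis t1 * cis t2 * cis t3 * add_mod (chordal b c t2 a) * cis (- pa)))%C
  with ((cis t1 * cis t1) * (cis t2 * cis t2) * (cis t3 * cis t3) * (cis (- pa) * cis (- pa))
    * (add_mod (chordal b c t2 a) * add_mod (chordal b c t2 a)))%C by ring.
rewrite add_mod_sqr, <- !cis_2.
replace (cis (2 * t1) * cis (2 * t2) * cis (2 * t3) * cis (2 * - pa) *
   ((2 * slit (chordal b c t2 a))%R * chordal b c t2 a))%C
  with ((2 * slit (chordal b c t2 a))%R * (cis (2 * t1) * cis (2 * - pa) * cis (2 * t3) *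
     (cis (2 * t2) * chordal b c t2 a)))%C by ring.
rewrite cis_chordal.
replace (cis (2 * t1) * cis (2 * - pa) * cis (2 * t3) * ((a - c) * Cconj (a - b)))%C
  with (- (cis (2 * t1) * cis (2 * - pa) * Cconj (a - b) * arr c a t3))%C
  by (unfold arr; ring).
rewrite E; unfold dep.
replace (- (cis (2 * t1) * cis (2 * - pa) * Cconj (a - b) *
    (l * ((b - a) * cis (- (2 * t1)) * cis (2 * pa)))))%C
  with (l * ((a - b) * Cconj (a - b)) * (cis (2 * t1) * cis (- (2 * t1))) *
        (cis (2 * - pa) * cis (2 * pa)))%C by ring.
replace (2 * - pa) with (- (2 * pa)) by ring.
rewrite cis_opp_l, cis_opp_r, mult_conj, (RtoC_mult (2 * _)), (RtoC_mult l); ring.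
Qed.

(** For [phi] between zero and a full turn the first sine is positive, while the second changes sign
    exactly at [phi = 2 * pa], on passing the other edge. *)
Lemma branch_limit (lam phi : R) : 0 < lam -> exists m, 0 < m /\
  Re (branch t1 t2 t3 (k1 0 (lam * (d1 * cis phi))) (k2 0 (lam * (d1 * cis phi)))
    (k3 0 (lam * (d1 * cis phi))))%C =
  m * (sin (phi / 2) * sin (phi / 2 - pa)) * Re z.
Proof.
intros Hl; destruct (initial_scaled_chordal_in _ _ _ _ _ _ _ _ _ S lam phi) as (l & Hl0 & E3).
generalize (initial_scaled_chordal_out a b t1 lam phi); intros E1; fold d1 in E1, E3.
fold (k1 0 (lam * (d1 * cis phi))%C) in E1; fold (k3 0 (lam * (d1 * cis phi))%C) in E3.
assert (D : 0 < Cmod d1 ^ 2) by apply Cmod_sqr_pos, (dep_neq_0 _ _ _ _ _ _ _ _ _ S).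
assert (A : 0 < lam * Cmod d1 ^ 2) by (apply Rmult_lt_0_compat; assumption).
assert (B : 0 < lam * l * Cmod d1 ^ 2)
  by (apply Rmult_lt_0_compat; [apply Rmult_lt_0_compat|]; assumption).
exists (4 * (lam * Cmod d1 ^ 2) * (lam * l * Cmod d1 ^ 2)); split.
{ apply Rmult_lt_0_compat; lra. }
rewrite E1, E3; replace (k2 0 (lam * (d1 * cis phi)))%C with (chordal b c t2 a)
  by (unfold k2; f_equal; ring).
replace (chordal b c t2 a) with (1 * chordal b c t2 a)%C at 1 by ring.
rewrite branch_scal, Re_scal by lra.
assert (M : forall t, add_mod (- cis t) = (1 - cis t)%C).
{ intros t; unfold add_mod; rewrite Cmod_opp, Cmod_cis; ring. }
unfold branch; rewrite !M.
replace (cis t1 * (1 - cis (- phi)) * (cis t2 * add_mod (chordal b c t2 a)) *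
      (cis t3 * (1 - cis (phi - 2 * pa))))%C
  with (cis t1 * cis t2 * cis t3 * add_mod (chordal b c t2 a) *
        ((1 - cis (- phi)) * (1 - cis (phi - 2 * pa))))%C by ring.
replace (- phi) with (- (2 * (phi / 2))) by field.
replace (phi - 2 * pa) with (2 * (phi / 2 - pa)) by field.
rewrite cis_half; replace (phi / 2 - pa - phi / 2) with (- pa) by ring.
replace (cis t1 * cis t2 * cis t3 * add_mod (chordal b c t2 a) *
     ((4 * sin (phi / 2) * sin (phi / 2 - pa))%R * cis (- pa)))%C
  with ((4 * sin (phi / 2) * sin (phi / 2 - pa))%R * z)%C by (unfold z; ring).
rewrite Re_scal; ring.
Qed.

(** The rescaled function has a nonzero limit, so its sign is already that of the limit at some
    small radius; [conn_side] carries the sign to [x]. *)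
Lemma side_reach (lam phi : R) (x : C) : 0 < lam -> free_dir pa phi ->
  reach P a (lam * (d1 * cis phi))%C x ->
  0 < side a b c t1 t2 t3 x * (sin (phi / 2) * sin (phi / 2 - pa) * Re z).
Proof.
intros Hl [F1 F2] (d & D & H).
destruct (branch_limit lam phi Hl) as (m & Hm & E).
destruct jump_factor_real as [_ Z].
set (e := (lam * (d1 * cis phi))%C) in *.
set (s0 := sin (phi / 2) * sin (phi / 2 - pa) * Re z).
assert (N : s0 <> 0).
{ generalize (simple_pa _ _ _ _ _ _ _ _ _ S); intros Hpa.
  assert (0 < sin (phi / 2)) by (apply sin_gt_0; lra).
  assert (sin (phi / 2 - pa) <> 0).
  { destruct (Rlt_dec phi (2 * pa)).
    - assert (0 < sin (- (phi / 2 - pa))) by (apply sin_gt_0; lra).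
      rewrite sin_neg in H1; lra.
    - assert (0 < sin (phi / 2 - pa)) by (apply sin_gt_0; lra); lra. }
  unfold s0; repeat apply Rmult_integral_contrapositive_currified; lra. }
destruct (continuous_pos
  (fun r : R => Re (branch t1 t2 t3 (k1 r e) (k2 r e) (k3 r e)) * s0) 0) as [d' H'].
{ apply cts_mult; [|apply cts_const]; apply cts_Re; apply Ccts_branch;
    unfold k1, k2, k3, chordal; cts. }
{ rewrite E; replace (m * (sin (phi / 2) * sin (phi / 2 - pa)) * Re z * s0)
    with (m * (s0 * s0)) by (unfold s0; ring).
  apply Rmult_lt_0_compat; [exact Hm|]; nra. }
set (r := Rmin d d' / 2).
assert (R0 : 0 < Rmin d d') by (apply Rmin_glb_lt; [exact D | apply cond_pos]).
generalize (Rmin_l d d') (Rmin_r d d'); intros R1 R2.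
assert (K : conn P (a + r * e)%C x).
{ apply H; [unfold r; lra | |]; rewrite Rminus_diag, Rabs_R0; exact D. }
apply conn_side in K; rewrite side_scaled in K by (unfold r; lra).
assert (J : 0 < Re (branch t1 t2 t3 (k1 r e) (k2 r e) (k3 r e)) * s0).
{ apply (H' r); change (Rabs (r - 0) < d'); rewrite Rminus_0_r, Rabs_pos_eq; unfold r; lra. }
set (B := Re (branch t1 t2 t3 (k1 r e) (k2 r e) (k3 r e))) in *.
set (X := side a b c t1 t2 t3 x) in *.
assert (0 < r ^ 2) by (apply pow_lt; unfold r; lra).
assert (K2 : 0 < B * X).
{ apply Rmult_lt_reg_l with (r ^ 2); [assumption|]; lra. }
assert (0 < (B * B) * (X * s0)) by (replace (B * B * (X * s0)) with (B * X * (B * s0)) by ring;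
  now apply Rmult_lt_0_compat).
assert (0 <= B * B) by nra.
apply Rnot_le_lt; intros L; nra.
Qed.

Lemma side_jump (x y : C) : near P a d1 0 (2 * pa) x -> near P a d1 (2 * pa) (2 * PI) y ->
  side a b c t1 t2 t3 x * side a b c t1 t2 t3 y < 0.
Proof.
intros (p & l & Hp & Hl & Rx) (q & m & Hq & Hm & Ry).
generalize (simple_pa _ _ _ _ _ _ _ _ _ S); intros Hpa.
apply side_reach in Rx; [|assumption | unfold free_dir; lra].
apply side_reach in Ry; [|assumption | unfold free_dir; lra].
assert (0 < sin (p / 2)) by (apply sin_gt_0; lra).
assert (0 < sin (q / 2)) by (apply sin_gt_0; lra).
assert (0 < sin (- (p / 2 - pa))) by (apply sin_gt_0; lra).
assert (0 < sin (q / 2 - pa)) by (apply sin_gt_0; lra).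
rewrite sin_neg in H1.
set (X := side a b c t1 t2 t3 x) in *; set (Y := side a b c t1 t2 t3 y) in *.
assert (X * Re z < 0).
{ replace (X * (sin (p / 2) * sin (p / 2 - pa) * Re z))
    with (- (sin (p / 2) * - sin (p / 2 - pa)) * (X * Re z)) in Rx by ring.
  assert (0 < sin (p / 2) * - sin (p / 2 - pa)) by now apply Rmult_lt_0_compat.
  apply Rnot_le_lt; intros L; nra. }
assert (0 < Y * Re z).
{ replace (Y * (sin (q / 2) * sin (q / 2 - pa) * Re z))
    with ((sin (q / 2) * sin (q / 2 - pa)) * (Y * Re z)) in Ry by ring.
  assert (0 < sin (q / 2) * sin (q / 2 - pa)) by now apply Rmult_lt_0_compat.
  apply Rnot_le_lt; intros L; nra. }
assert ((X * Y) * (Re z * Re z) < 0) by (replace (X * Y * (Re z * Re z)) with (X * Re z * (Y * Re z)) by ring; nra).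
assert (0 <= Re z * Re z) by nra.
apply Rnot_le_lt; intros L; nra.
Qed.

End Jump.

(** * Arcs in chordal form *)

Lemma not_avoids (a b x : C) (t r : R) :
  chordal a b t x = RtoC r -> (~ avoids a b t x <-> r <= 0).
Proof.
unfold avoids; intros ->; rewrite slit_pos_neq.
generalize (slit_eq_0 r); rewrite Re_RtoC, Im_RtoC; intros H; split; intros K.
- destruct (Req_dec (slit r) 0); tauto.
- intros L; apply L, H; auto.
Qed.

(** The difference quotient completed by the derivative at zero, which puts a drawn arc into the
    form expected by [near_curve]. *)
Lemma slope (F : R -> R) (l : R) : derivable_pt_lim F 0 l ->
  exists s : R -> R, continuous s 0 /\ s 0 = l /\ forall t, F t = F 0 + t * s t.
Proof.
intros H; exists (fun t => if Req_EM_T t 0 then l else (F t - F 0) / t).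
assert (E : (if Req_EM_T 0 0 then l else (F 0 - F 0) / 0) = l).
{ destruct (Req_EM_T 0 0); [reflexivity | congruence]. }
split; [|split].
- intros Q; rewrite E; intros [e He].
  destruct (H e (cond_pos e)) as [d Hd]; exists d; intros y Hy; apply He.
  change (Rabs (y - 0) < d) in Hy; rewrite Rminus_0_r in Hy.
  destruct (Req_EM_T y 0); [apply ball_center|].
  specialize (Hd y n Hy); rewrite Rplus_0_l in Hd; exact Hd.
- exact E.
- intros t; destruct (Req_EM_T t 0) as [->|N]; [ring | field; exact N].
Qed.

Lemma arc_param_slope (g : arc) : arc_wf g -> exists (f : R -> C) (l : R),
  0 < l /\ Ccts f 0 /\ f 0 = (l * dir_start g)%C /\
  forall t, arc_param g t = (arc_start g + t * f t)%C.
Proof.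
destruct g as [p q | cx cy r phi delta]; simpl arc_wf.
- intros _; exists (fun _ => (q - p)%C), 1; split; [lra|]; split; [cts|]; split.
  + rewrite Cmult_1_l; reflexivity.
  + intros t; unfold arc_start; apply C_eq; unfold Re, Im; simpl; ring.
- intros (Hr & _ & _).
  destruct (slope (fun t => cx + r * cos (phi + t * delta)) (r * (- delta * sin phi)))
    as (s1 & C1 & E1 & F1).
  { auto_derive; [easy|]; rewrite Rmult_0_l, Rplus_0_r; ring. }
  destruct (slope (fun t => cy + r * sin (phi + t * delta)) (r * (delta * cos phi)))
    as (s2 & C2 & E2 & F2).
  { auto_derive; [easy|]; rewrite Rmult_0_l, Rplus_0_r; ring. }
  exists (fun t => (s1 t, s2 t)), r; split; [exact Hr|]; split; [split; assumption|].
  split.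
  + apply C_eq; rewrite ?Re_scal, ?Im_scal; unfold Re, Im; simpl; assumption.
  + intros t; unfold arc_start; apply C_eq;
      rewrite ?Re_plus, ?Im_plus, ?Re_scal, ?Im_scal; unfold Re, Im; simpl; [apply F1 | apply F2].
Qed.

(** For positive [delta] the second sine is nonnegative and the first has the sign of [t - 1];
    reflection gives negative [delta]. *)
Lemma circ_sign (delta t : R) : delta <> 0 -> - (2 * PI) < delta < 2 * PI ->
  0 <= t -> - (2 * PI) < t * delta < 2 * PI ->
  (sin ((t * delta - delta) / 2) * sin (t * delta / 2) <= 0 <-> t <= 1).
Proof.
assert (pos : forall e, 0 < e < 2 * PI -> 0 <= t -> t * e < 2 * PI ->
  (sin ((t * e - e) / 2) * sin (t * e / 2) <= 0 <-> t <= 1)).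
{ intros e He Ht He2; assert (0 <= t * e) by nra.
  assert (A : 0 <= sin (t * e / 2)) by (apply sin_ge_0; lra).
  split; intros K.
  - apply Rnot_lt_le; intros L.
    assert (0 < t * e) by nra; assert (0 < t * e - e) by nra.
    assert (0 < sin (t * e / 2)) by (apply sin_gt_0; lra).
    assert (0 < sin ((t * e - e) / 2)) by (apply sin_gt_0; lra); nra.
  - assert (t * e - e <= 0) by nra.
    assert (0 <= sin (- ((t * e - e) / 2))) by (apply sin_ge_0; lra).
    rewrite sin_neg in H1; nra. }
intros H0 Hd Ht Hd2; destruct (Rlt_dec 0 delta).
- apply pos; lra.
- replace (t * delta / 2) with (- (t * - delta / 2)) by field.
  replace ((t * delta - delta) / 2) with (- ((t * - delta - - delta) / 2)) by field.
  rewrite !sin_neg, Rmult_opp_opp; apply pos; lra.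
Qed.

Section Circle.
Variables (o : C) (r phi delta : R).
Let a : C := (o + r * cis phi)%C.
Let b : C := (o + r * cis (phi + delta))%C.

(** The inscribed angle theorem: both chords from the moving point are half-angle sines times unit
    vectors, and the turn by [delta / 2] cancels the direction that remains. *)
Lemma chordal_circle (s : R) :
  chordal a b (delta / 4) (o + r * cis (phi + s))%C =
  RtoC (4 * r ^ 2 * (sin ((s - delta) / 2) * sin (s / 2))).
Proof.
unfold chordal, a, b.
replace (o + r * cis (phi + s) - (o + r * cis (phi + delta)))%C
  with (r * (cis (phi + s) * (1 - cis (- (2 * ((s - delta) / 2))))))%C.
2: { replace (phi + delta) with (phi + s + - (2 * ((s - delta) / 2))) by field.
     rewrite (cis_plus (phi + s)); ring. }
replace (o + r * cis (phi + s) - (o + r * cis phi))%C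
  with (r * (cis (phi + s) * (1 - cis (- s))))%C.
2: { replace phi with (phi + s + - s) at 3 by ring; rewrite (cis_plus (phi + s)); ring. }
rewrite !Cmult_conj, Cminus_conj, !conj_RtoC, <- !cis_opp.
replace (- - s) with (2 * (s / 2)) by field.
replace (r * (cis (phi + s) * (1 - cis (- (2 * ((s - delta) / 2))))) *
    (r * (cis (- (phi + s)) * (1 - cis (2 * (s / 2))))) * cis (- (2 * (delta / 4))))%C
  with (r * r * (cis (phi + s) * cis (- (phi + s))) *
    ((1 - cis (- (2 * ((s - delta) / 2)))) * (1 - cis (2 * (s / 2)))) *
    cis (- (2 * (delta / 4))))%C by ring.
rewrite cis_opp_r, cis_half.
replace (s / 2 - (s - delta) / 2) with (2 * (delta / 4)) by field.
replace (r * r * 1 * ((4 * sin ((s - delta) / 2) * sin (s / 2))%R * cis (2 * (delta / 4))) *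
    cis (- (2 * (delta / 4))))%C
  with (r * r * (4 * sin ((s - delta) / 2) * sin (s / 2))%R *
    (cis (2 * (delta / 4)) * cis (- (2 * (delta / 4)))))%C by ring.
rewrite cis_opp_r, Cmult_1_r, <- !RtoC_mult; f_equal; ring.
Qed.

(** Since the sine is nonzero for an admissible sweep, [chordal] is real exactly on the full circle;
    the sign found in [chordal_circle] then cuts out the arc. *)
Lemma Im_chordal_circle (x : C) :
  Im (chordal a b (delta / 4) x) = sin (delta / 2) * (r ^ 2 - Cmod (x - o) ^ 2).
Proof.
set (y := (x - o)%C); set (w := (y * cis (- (phi + delta / 2)))%C).
assert (E : chordal a b (delta / 4) x =
  (RtoC (Cmod y ^ 2) * cis (- (delta / 2)) + RtoC (r ^ 2) * cis (delta / 2)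
   - r * (w + Cconj w))%C).
{ unfold chordal, a, b, w.
  replace (x - (o + r * cis (phi + delta)))%C with (y - r * cis (phi + delta))%C
    by (unfold y; ring).
  replace (x - (o + r * cis phi))%C with (y - r * cis phi)%C by (unfold y; ring).
  rewrite Cminus_conj, !Cmult_conj, conj_RtoC, <- !cis_opp, <- mult_conj.
  replace (- (2 * (delta / 4))) with (- (delta / 2)) by field.
  rewrite Ropp_involutive.
  replace (- (phi + delta / 2)) with (- phi + - (delta / 2)) by ring.
  replace (phi + delta) with (phi + delta / 2 + delta / 2) by field.
  rewrite !cis_plus.
  replace (RtoC (r ^ 2)) with (r * r)%C by (rewrite <- RtoC_mult; f_equal; ring).
  generalize (cis_opp_r phi) (cis_opp_r (delta / 2)); intros K1 K2.
  replace ((y - r * (cis phi * cis (delta / 2) * cis (delta / 2))) *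
    (Cconj y - r * cis (- phi)) * cis (- (delta / 2)))%C with
    (y * Cconj y * cis (- (delta / 2)) - r * y * (cis (- phi) * cis (- (delta / 2)))
     - r * Cconj y * cis phi * cis (delta / 2) * (cis (delta / 2) * cis (- (delta / 2)))
     + r * r * cis (delta / 2) * (cis phi * cis (- phi)) * (cis (delta / 2) * cis (- (delta / 2))))%C
    by ring.
  rewrite K1, K2; ring. }
rewrite E; unfold cis, Re, Im; simpl; rewrite sin_neg; ring.
Qed.

Lemma circle_arc (x : C) : 0 < r -> delta <> 0 -> - (2 * PI) < delta < 2 * PI ->
  ((exists t, 0 <= t <= 1 /\ (o + r * cis (phi + t * delta))%C = x) <->
   ~ avoids a b (delta / 4) x).
Proof.
intros Hr H0 Hd; split.
- intros (t & Ht & <-).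
  apply (not_avoids _ _ _ _ _ (chordal_circle (t * delta))).
  assert (- (2 * PI) < t * delta < 2 * PI) by (split; nra).
  generalize (proj2 (circ_sign delta t H0 Hd (proj1 Ht) H) (proj2 Ht)); intros K.
  assert (0 < r ^ 2) by (apply pow_lt; exact Hr); nra.
- intros H.
  assert (Hs : slit (chordal a b (delta / 4) x) = 0).
  { unfold avoids in H; generalize (slit_ge_0 (chordal a b (delta / 4) x)); lra. }
  apply slit_eq_0 in Hs; destruct Hs as [Hi _].
  rewrite Im_chordal_circle in Hi.
  assert (N : sin (delta / 2) <> 0).
  { destruct (Rlt_dec 0 delta).
    - assert (0 < sin (delta / 2)) by (apply sin_gt_0; lra); lra.
    - assert (J : 0 < sin (- (delta / 2))) by (apply sin_gt_0; lra); rewrite sin_neg in J; lra. }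
  apply Rmult_integral in Hi; destruct Hi as [Hi|Hi]; [contradiction|].
  assert (Hm : Cmod (x - o) = r).
  { generalize (Cmod_ge_0 (x - o)); intros; nra. }
  destruct (polar ((x - o) * cis (- phi))%C) as (u & Hu & E).
  rewrite Cmod_mult, Cmod_cis, Hm, Rmult_1_r in E.
  assert (Ex : forall s, cis s = cis u -> (o + r * cis (phi + s))%C = x).
  { intros s Es; rewrite cis_plus, Es.
    replace (o + r * (cis phi * cis u))%C with (o + cis phi * (r * cis u))%C by ring.
    rewrite <- E.
    replace (o + cis phi * ((x - o) * cis (- phi)))%C
      with (o + (x - o) * (cis phi * cis (- phi)))%C by ring.
    rewrite cis_opp_r; ring. }
  (* The angle is shifted by a full turn if necessary so that it runs in the sense of [delta] and
     yields a nonnegative parameter. *)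
  assert (exists s, cis s = cis u /\ 0 <= s / delta /\ - (2 * PI) < s < 2 * PI)
    as (s & Es & Hs0 & Hs).
  { assert (Per : cis (u + 2 * PI) = cis u /\ cis (u - 2 * PI) = cis u).
    { generalize (cos_2PI) (sin_2PI); intros c2 s2; unfold cis; split; f_equal;
        rewrite ?cos_plus, ?cos_minus, ?sin_plus, ?sin_minus, c2, s2; ring. }
    generalize PI_RGT_0; intros.
    destruct (Rlt_dec 0 delta).
    - assert (0 < / delta) by now apply Rinv_0_lt_compat.
      destruct (Rlt_dec u 0).
      + exists (u + 2 * PI); repeat split; try tauto; try lra; apply Rmult_le_pos; lra.
      + exists u; repeat split; try tauto; try lra; apply Rmult_le_pos; lra.
    - assert (/ delta < 0) by (apply Rinv_lt_0_compat; lra).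
      destruct (Rlt_dec 0 u).
      + exists (u - 2 * PI); repeat split; try tauto; try lra; unfold Rdiv; nra.
      + exists u; repeat split; try tauto; try lra; unfold Rdiv; nra. }
  assert (Esd : s / delta * delta = s) by (field; exact H0).
  exists (s / delta); rewrite Esd; split; [|now apply Ex].
  split; [exact Hs0|]; apply (circ_sign delta (s / delta) H0 Hd Hs0); rewrite Esd; [exact Hs|].
  rewrite <- (Ex s Es) in H.
  apply (not_avoids _ _ _ _ _ (chordal_circle s)) in H.
  assert (0 < r ^ 2) by (apply pow_lt; exact Hr); nra.
Qed.

Lemma dep_circle :
  dep a b (delta / 4) = ((2 * r * sin (delta / 2))%R * (Ci * cis phi))%C.
Proof.
unfold dep, a, b.
replace (o + r * cis (phi + delta) - (o + r * cis phi))%C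
  with (r * (cis (phi + delta) - cis phi))%C by ring.
replace (phi + delta) with (phi + 2 * (delta / 2)) by field.
replace (- (2 * (delta / 4))) with (- (delta / 2)) by field.
set (h := delta / 2); rewrite cis_plus, cis_2.
replace (r * (cis phi * (cis h * cis h) - cis phi) * cis (- h))%C
  with (r * cis phi * (cis h * (cis h * cis (- h)) - cis (- h)))%C by ring.
rewrite cis_opp_r.
replace (cis h * 1 - cis (- h))%C with ((2 * sin h)%R * Ci)%C.
- rewrite !RtoC_mult; ring.
- apply C_eq; unfold cis, Re, Im; simpl; rewrite ?cos_neg, ?sin_neg; ring.
Qed.

Lemma arr_circle :
  arr a b (delta / 4) = ((2 * r * sin (delta / 2))%R * - (Ci * cis (phi + delta)))%C.
Proof.
unfold arr, a, b.
replace (o + r * cis phi - (o + r * cis (phi + delta)))%C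
  with (r * (cis phi - cis (phi + delta)))%C by ring.
replace (phi + delta) with (phi + 2 * (delta / 2)) by field.
replace (2 * (delta / 4)) with (delta / 2) by field.
set (h := delta / 2); rewrite cis_plus, cis_2.
replace (cis phi - cis phi * (cis h * cis h))%C
  with (cis phi * cis h * (1 * cis (- h) - cis h))%C.
2: { replace (cis phi * cis h * (1 * cis (- h) - cis h))%C
       with (cis phi * (cis h * cis (- h)) - cis phi * (cis h * cis h))%C by ring.
     rewrite cis_opp_r; ring. }
replace (1 * cis (- h) - cis h)%C with (- ((2 * sin h)%R * Ci))%C.
- rewrite !RtoC_mult; ring.
- apply C_eq; unfold cis, Re, Im; simpl; rewrite ?cos_neg, ?sin_neg; ring.
Qed.

End Circle.

Lemma arc_chordal (g : arc) : arc_wf g -> exists th : R,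
  - (PI / 2) < th < PI / 2 /\
  (forall x, arc_image g x <-> ~ avoids (arc_start g) (arc_end g) th x) /\
  (exists l, 0 < l /\ dir_start g = (l * dep (arc_start g) (arc_end g) th)%C) /\
  (exists l, 0 < l /\ dir_end g = (l * arr (arc_start g) (arc_end g) th)%C).
Proof.
generalize PI_RGT_0; intros Hpi.
destruct g as [p q | cx cy r phi delta]; simpl arc_wf.
- intros Hpq.
  assert (Ea : arc_start (Seg p q) = p) by (apply C_eq; unfold Re, Im; simpl; ring).
  assert (Eb : arc_end (Seg p q) = q) by (apply C_eq; unfold Re, Im; simpl; ring).
  rewrite Ea, Eb; exists 0; split; [lra|]; split; [|split].
  + assert (N : 0 < Cmod (q - p) ^ 2) by (apply Cmod_sqr_pos, Cminus_neq_0; congruence).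
    assert (Eq : forall t, arc_param (Seg p q) t = (p + t * (q - p))%C).
    { intros t; apply C_eq; unfold Re, Im; simpl; ring. }
    intros x; split.
    * intros (t & Ht & <-); rewrite Eq.
      assert (E : chordal p q 0 (p + t * (q - p))%C = RtoC ((t - 1) * t * Cmod (q - p) ^ 2)).
      { unfold chordal; replace (- (2 * 0)) with 0 by ring; rewrite cis_0.
        replace (p + t * (q - p) - q)%C with ((t - 1)%R * (q - p))%C
          by (rewrite RtoC_minus; ring).
        replace (p + t * (q - p) - p)%C with (t * (q - p))%C by ring.
        rewrite Cmult_conj, conj_RtoC, (RtoC_mult (_ * _)), <- mult_conj, RtoC_mult; ring. }
      apply (not_avoids _ _ _ _ _ E); assert ((t - 1) * t <= 0) by nra; nra.
    * intros H.
      assert (Hs : slit (chordal p q 0 x) = 0).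
      { unfold avoids in H; generalize (slit_ge_0 (chordal p q 0 x)); lra. }
      apply slit_eq_0 in Hs; unfold chordal in Hs.
      replace (- (2 * 0)) with 0 in Hs by ring; rewrite cis_0, Cmult_1_r in Hs.
      set (z := ((x - p) / (q - p))%C).
      assert (Nq : (q - p)%C <> 0%C) by (apply Cminus_neq_0; congruence).
      assert (Ex : (x - p)%C = (z * (q - p))%C) by (unfold z; field; exact Nq).
      assert (K : ((x - q) * Cconj (x - p))%C
        = (RtoC (Cmod (q - p) ^ 2) * ((z - 1) * Cconj z))%C).
      { replace (x - q)%C with ((x - p) - (q - p))%C by ring.
        rewrite Ex, Cmult_conj, <- mult_conj; ring. }
      rewrite K, Re_scal, Im_scal in Hs; destruct Hs as [Hi Hr].
      assert (Zi : Im z = 0).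
      { rewrite Im_mult, re_conj, im_conj, Re_minus, Im_minus, Re_RtoC, Im_RtoC in Hi.
        apply Rmult_integral in Hi; lra. }
      assert (Zr : (Re z - 1) * Re z <= 0).
      { rewrite Re_mult, re_conj, im_conj, Re_minus, Im_minus, Re_RtoC, Im_RtoC, Zi in Hr.
        apply Rnot_lt_le; intros L; nra. }
      exists (Re z); split; [nra|]; rewrite Eq, <- (RtoC_real z Zi), <- Ex.
      apply C_eq; unfold Re, Im; simpl; ring.
  + exists 1; split; [lra|]; unfold dep; replace (- (2 * 0)) with 0 by ring.
    rewrite cis_0, Cmult_1_l, Cmult_1_r; reflexivity.
  + exists 1; split; [lra|]; unfold arr; replace (2 * 0) with 0 by ring.
    rewrite cis_0, Cmult_1_l, Cmult_1_r; reflexivity.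
- intros (Hr & H0 & Hd).
  set (o := (cx, cy) : C).
  assert (Eq : forall t, arc_param (Circ cx cy r phi delta) t = (o + r * cis (phi + t * delta))%C).
  { intros t; apply C_eq; unfold o, cis, Re, Im; simpl; ring. }
  assert (Ea : arc_start (Circ cx cy r phi delta) = (o + r * cis phi)%C).
  { unfold arc_start; rewrite Eq; do 3 f_equal; ring. }
  assert (Eb : arc_end (Circ cx cy r phi delta) = (o + r * cis (phi + delta))%C).
  { unfold arc_end; rewrite Eq; do 3 f_equal; ring. }
  rewrite Ea, Eb; exists (delta / 4); split; [lra|].
  (* The ratio of the tangent vector to [dep], and likewise to [arr]; it is positive because [delta]
     and the sine of its half have the same sign. *)
  assert (Hl : 0 < delta / (2 * r * sin (delta / 2)) /\ sin (delta / 2) <> 0).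
  { destruct (Rlt_dec 0 delta).
    - assert (0 < sin (delta / 2)) by (apply sin_gt_0; lra).
      split; [|lra]; apply Rdiv_lt_0_compat; [lra|]; repeat apply Rmult_lt_0_compat; lra.
    - assert (0 < sin (- (delta / 2))) by (apply sin_gt_0; lra).
      rewrite sin_neg in H; split; [|lra].
      replace (delta / (2 * r * sin (delta / 2)))
        with (- delta / (2 * r * - sin (delta / 2))) by (field; lra).
      apply Rdiv_lt_0_compat; [lra|]; repeat apply Rmult_lt_0_compat; lra. }
  destruct Hl as [Hl Hs]; split; [|split].
  + intros x; rewrite <- circle_arc by assumption.
    split; intros (t & Ht & E); exists t; split; try exact Ht; rewrite <- E, Eq; reflexivity.
  + exists (delta / (2 * r * sin (delta / 2))); split; [exact Hl|].
    rewrite dep_circle, Cmult_assoc, <- RtoC_mult.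
    replace (delta / (2 * r * sin (delta / 2)) * (2 * r * sin (delta / 2))) with delta
      by (field; lra).
    apply C_eq; unfold cis, Re, Im; simpl; ring.
  + exists (delta / (2 * r * sin (delta / 2))); split; [exact Hl|].
    rewrite arr_circle, Cmult_assoc, <- RtoC_mult.
    replace (delta / (2 * r * sin (delta / 2)) * (2 * r * sin (delta / 2))) with delta
      by (field; lra).
    apply C_eq; unfold cis, Re, Im; simpl; ring.
Qed.

(** * Three arcs meeting at 60 degrees *)

Lemma cis_neg_real (t r : R) : - PI < t < PI -> r < 0 -> cis t <> RtoC r.
Proof.
intros Ht Hr E.
assert (Es : sin t = 0) by exact (f_equal Im E).
assert (Ec : cos t = r) by exact (f_equal Re E).
destruct (Rtotal_order t 0) as [L|[->|L]].
- assert (0 < sin (- t)) by (apply sin_gt_0; lra); rewrite sin_neg in H; lra.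
- rewrite cos_0 in Ec; lra.
- assert (0 < sin t) by (apply sin_gt_0; lra); lra.
Qed.

(** Trace and norm equal to 1 make [w] a primitive sixth root of unity without saying which, so the
    two mirror images are handled together. *)
Lemma no_mixed_triangle (a b c : C) (t1 t2 t3 pa pb pc : R) (w : C) :
  simple a b c t1 t2 t3 pa pb pc ->
  (w + Cconj w)%C = 1%C -> (w * Cconj w)%C = 1%C ->
  cis (2 * pa) = w -> cis (2 * pb) = w -> cis (2 * pc) = Cconj w -> False.
Proof.
intros S Hw1 Hw2 Ea Eb Ec.
destruct (simple_angle_a _ _ _ _ _ _ _ _ _ S) as (l1 & L1 & A1).
destruct (simple_angle_b _ _ _ _ _ _ _ _ _ S) as (l2 & L2 & A2).
destruct (simple_angle_c _ _ _ _ _ _ _ _ _ S) as (l3 & L3 & A3).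
rewrite Ea in A1; rewrite Eb in A2; rewrite Ec in A3; unfold arr, dep in A1, A2, A3.
set (u := Cconj w) in *.
(* This sign is what makes the ratio of [q] to [p * E1] real rather than imaginary. *)
assert (W3 : (w * w * w)%C = (- (1))%C).
{ assert (E1 : u = (1 - w)%C) by (rewrite <- Hw1; ring).
  assert (E2 : (w * w)%C = (w - 1)%C).
  { replace (w * w)%C with (w - w * (1 - w))%C by ring; rewrite <- E1, Hw2; reflexivity. }
  rewrite E2; replace ((w - 1) * w)%C with (w * w - w)%C by ring; rewrite E2; ring. }
set (E1 := cis (2 * t1)) in *; set (E2 := cis (2 * t2)) in *; set (E3 := cis (2 * t3)) in *.
set (F1 := cis (- (2 * t1))) in *; set (F2 := cis (- (2 * t2))) in *;
  set (F3 := cis (- (2 * t3))) in *.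
assert (EF1 : (E1 * F1)%C = 1%C) by apply cis_opp_r.
assert (EF2 : (E2 * F2)%C = 1%C) by apply cis_opp_r.
assert (EF3 : (E3 * F3)%C = 1%C) by apply cis_opp_r.
set (p := (a - c)%C); set (q := (b - c)%C).
assert (Np : p <> 0%C).
{ apply Cminus_neq_0; generalize (simple_ca _ _ _ _ _ _ _ _ _ S); congruence. }
assert (Nq : q <> 0%C) by (apply Cminus_neq_0, (simple_bc _ _ _ _ _ _ _ _ _ S)).
assert (Npq : (p - q)%C <> 0%C).
{ replace (p - q)%C with (a - b)%C by (unfold p, q; ring).
  apply Cminus_neq_0, (simple_ab _ _ _ _ _ _ _ _ _ S). }
assert (B1 : (p * E1 * E3)%C = (l1 * (p - q) * w)%C).
{ replace (p * E1 * E3)%C with (- ((c - a) * E3) * E1)%C by (unfold p; ring); rewrite A1.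
  replace (- (l1 * ((b - a) * F1 * w)) * E1)%C with (l1 * (p - q) * w * (E1 * F1))%C
    by (unfold p, q; ring).
  rewrite EF1; ring. }
assert (B2 : ((p - q) * E1 * E2)%C = (- (l2 * q * w))%C).
{ replace ((p - q) * E1 * E2)%C with ((a - b) * E1 * E2)%C by (unfold p, q; ring); rewrite A2.
  replace (l2 * ((c - b) * F2 * w) * E2)%C with (- (l2 * q * w) * (E2 * F2))%C
    by (unfold p, q; ring).
  rewrite EF2; ring. }
assert (B3 : (q * E2 * E3)%C = (l3 * p * u)%C).
{ unfold q; rewrite A3; fold p.
  replace (l3 * (p * F3 * u) * E3)%C with (l3 * p * u * (E3 * F3))%C by ring.
  rewrite EF3; ring. }
clear A1 A2 A3.
(* Multiplying the three angle relations gives [(p E1)^2 = (l1 l2 / l3) q^2]. *)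
assert (Sq : (l3 * (p * E1) * (p * E1))%C = (l1 * l2 * q * q)%C).
{ assert (K : (p * E1 * E1 * E2 * E3)%C = (- (l1 * l2 * q * w * w))%C).
  { apply (Cmult_cancel_r _ _ (p - q) Npq).
    replace (p * E1 * E1 * E2 * E3 * (p - q))%C
      with ((p * E1 * E3) * ((p - q) * E1 * E2))%C by ring.
    rewrite B1, B2; ring. }
  replace (l3 * (p * E1) * (p * E1))%C
    with ((l3 * p * u) * (p * E1 * E1) * w + l3 * p * p * E1 * E1 * (1 - w * u))%C by ring.
  rewrite <- B3, Hw2.
  replace (q * E2 * E3 * (p * E1 * E1) * w + l3 * p * p * E1 * E1 * (1 - 1))%C
    with (q * (p * E1 * E1 * E2 * E3) * w)%C by ring.
  rewrite K.
  replace (q * - (l1 * l2 * q * w * w) * w)%C with (- (l1 * l2 * q * q * (w * w * w)))%C by ring.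
  rewrite W3; ring. }
set (mu := sqrt (l3 / (l1 * l2))).
assert (L12 : 0 < l1 * l2) by now apply Rmult_lt_0_compat.
assert (Mu : 0 < mu) by (apply sqrt_lt_R0, Rdiv_lt_0_compat; assumption).
assert (Mu2 : l1 * l2 * (mu * mu) = l3).
{ unfold mu; rewrite sqrt_sqrt by (left; apply Rdiv_lt_0_compat; assumption); field; lra. }
(* Either way [chordal a b t1 c] is real. The negative root puts [c] on the arc itself, the positive
   one on the rest of its circle or line. *)
assert (Or : q = (- (mu * (p * E1)))%C \/ q = (mu * (p * E1))%C).
{ assert (K : ((q + mu * (p * E1)) * (q - mu * (p * E1)))%C = 0%C).
  { apply (Cmult_cancel_r _ _ (RtoC (l1 * l2)) (RtoC_neq_0 _ (Rgt_not_eq _ _ L12))).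
    replace ((q + mu * (p * E1)) * (q - mu * (p * E1)) * (l1 * l2)%R)%C
      with ((l1 * l2)%R * q * q - ((l1 * l2)%R * (mu * mu)) * (p * E1) * (p * E1))%C by ring.
    rewrite Cmult_0_l, <- !RtoC_mult, Mu2, Sq, RtoC_mult; ring. }
  destruct (Ceq_dec (q + mu * (p * E1))%C 0%C) as [Z|Z].
  - left; replace q with ((q + mu * (p * E1)) - mu * (p * E1))%C by ring; rewrite Z; ring.
  - right; destruct (Ceq_dec (q - mu * (p * E1))%C 0%C) as [Z'|Z'].
    + replace q with ((q - mu * (p * E1)) + mu * (p * E1))%C by ring; rewrite Z'; ring.
    + exfalso; revert K; apply Cmult_neq_0; assumption. }
destruct Or as [Hq|Hq].
- (* here [c] lies on the arc from [a] to [b] *)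
  assert (Hc : chordal a b t1 c = RtoC (- (mu * Cmod p ^ 2))).
  { unfold chordal; fold F1; replace (c - b)%C with (- q)%C by (unfold q; ring).
    replace (c - a)%C with (- p)%C by (unfold p; ring).
    rewrite Hq, Copp_conj.
    replace (- - (mu * (p * E1)) * - Cconj p * F1)%C
      with (- (mu * (p * Cconj p)) * (E1 * F1))%C by ring.
    rewrite EF1, mult_conj, RtoC_opp, RtoC_mult; ring. }
  destruct (simple_disj_b _ _ _ _ _ _ _ _ _ S c) as [H|H].
  + generalize (simple_bc _ _ _ _ _ _ _ _ _ S); congruence.
  + revert H; apply (not_avoids _ _ _ _ _ Hc).
    generalize (Cmod_sqr_pos p Np); intros; nra.
  + apply avoids_neq in H; tauto.
- (* here the arcs at [c] meet again at [c + p / (1 + t E3)] *)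
  set (t := / (mu * l1)); set (s := l2 * mu).
  assert (T0 : 0 < t) by (apply Rinv_0_lt_compat, Rmult_lt_0_compat; assumption).
  assert (S0 : 0 < s) by (apply Rmult_lt_0_compat; assumption).
  assert (Emu : t * mu * l1 = 1) by (unfold t; field; lra).
  set (v := (1 - mu * E1)%C).
  assert (G1 : (E1 * E3)%C = (l1 * v * w)%C).
  { apply (Cmult_cancel_r _ _ p Np).
    replace (E1 * E3 * p)%C with (p * E1 * E3)%C by ring; rewrite B1, Hq; unfold v; ring. }
  assert (G2 : (s * F2)%C = (- (v * u))%C).
  { assert (K : (v * E2)%C = (- (l2 * mu * w))%C).
    { assert (NE : (p * E1)%C <> 0%C) by (apply Cmult_neq_0; [exact Np | apply cis_neq_0]).
      apply (Cmult_cancel_r _ _ _ NE).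
      replace (v * E2 * (p * E1))%C with ((p - mu * (p * E1)) * E1 * E2)%C by (unfold v; ring).
      rewrite <- Hq, B2, Hq at 1; ring. }
    replace (- (v * u))%C with (- (v * (E2 * F2) * u))%C by (rewrite EF2; ring).
    replace (v * (E2 * F2) * u)%C with ((v * E2) * F2 * u)%C by ring.
    rewrite K; unfold s; rewrite RtoC_mult.
    replace (- (- (l2 * mu * w) * F2 * u))%C with (l2 * mu * F2 * (w * u))%C by ring.
    rewrite Hw2; ring. }
  (* Under the map from [x] to [1 / (x - c)] the two arcs ending at [c] become rays from [1 / p] and
     [1 / q] in the directions [E3 / p] and [F2 / q]. The values [t] and [s] are the parameters of
     their crossing, where [D / p = G / q]. *)
  set (D := (1 + t * E3)%C); set (G := (1 + s * F2)%C).
  assert (DG : (mu * E1 * D)%C = G).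
  { unfold D, G; rewrite G2.
    replace (mu * E1 * (1 + t * E3))%C with (mu * E1 + t * mu * (E1 * E3))%C by ring.
    rewrite G1.
    replace (t * mu * (l1 * v * w))%C with (t * mu * l1 * (v * w))%C by ring.
    rewrite <- !RtoC_mult, Emu.
    replace (mu * E1)%C with (1 - v)%C by (unfold v; ring).
    replace (1 - v + 1 * (v * w))%C with (1 - v * u + v * ((w + u) - 1))%C by ring.
    rewrite Hw1; ring. }
  (* A zero [D] would move the second meeting point to infinity and force [2 * t3] to an odd
     multiple of [PI]. *)
  assert (ND : D <> 0%C).
  { intros Z; generalize (simple_t3 _ _ _ _ _ _ _ _ _ S); intros Ht3.
    apply (cis_neg_real (2 * t3) (- / t)); [lra | | ].
    - generalize (Rinv_0_lt_compat t T0); lra.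
    - fold E3; assert (Nt : RtoC t <> 0%C) by (apply RtoC_neq_0; lra).
      apply (Cmult_cancel_r _ _ _ Nt); rewrite RtoC_opp, RtoC_inv by lra.
      replace (E3 * t)%C with (D - 1)%C by (unfold D; ring); rewrite Z; field; exact Nt. }
  assert (NG : G <> 0%C).
  { rewrite <- DG; apply Cmult_neq_0; [|exact ND].
    apply Cmult_neq_0; [apply RtoC_neq_0; lra | apply cis_neq_0]. }
  set (X := (c + p / D)%C).
  assert (XG : X = (c + q / G)%C).
  { unfold X; rewrite <- DG, Hq; field; split; [exact ND|].
    split; [apply cis_neq_0 | apply RtoC_neq_0; lra]. }
  assert (NX : X <> c).
  { intros Z; assert (K : (p / D)%C = 0%C).
    { replace (p / D)%C with (X - c)%C by (unfold X; ring); rewrite Z; ring. }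
    revert K; apply Cmult_neq_0; [exact Np | now apply Cinv_neq_0]. }
  assert (H3 : chordal c a t3 X = RtoC (- (t * Cmod (p / D) ^ 2))).
  { unfold chordal; fold F3; unfold X.
    replace (c + p / D - a)%C with (- (t * E3) * (p / D))%C
      by (replace (t * E3)%C with (D - 1)%C by (unfold D; ring); unfold p; field; exact ND).
    replace (c + p / D - c)%C with (p / D)%C by ring.
    replace (- (t * E3) * (p / D) * Cconj (p / D) * F3)%C
      with (- (t * (p / D * Cconj (p / D))) * (E3 * F3))%C by ring.
    rewrite EF3, mult_conj, RtoC_opp, RtoC_mult; ring. }
  assert (H2 : chordal b c t2 X = RtoC (- (s * Cmod (q / G) ^ 2))).
  { unfold chordal; fold F2; rewrite XG.
    replace (c + q / G - b)%C with (- (s * F2) * (q / G))%C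
      by (replace (s * F2)%C with (G - 1)%C by (unfold G; ring); unfold q; field; exact NG).
    replace (c + q / G - c)%C with (q / G)%C by ring.
    rewrite Cmult_conj, Copp_conj, Cmult_conj, conj_RtoC.
    replace (Cconj F2) with E2 by (unfold F2, E2; rewrite <- cis_opp, Ropp_involutive; reflexivity).
    replace (q / G * (- (s * E2) * Cconj (q / G)) * F2)%C
      with (- (s * (q / G * Cconj (q / G))) * (E2 * F2))%C by ring.
    rewrite EF2, mult_conj, RtoC_opp, RtoC_mult; ring. }
  destruct (simple_disj_c _ _ _ _ _ _ _ _ _ S X NX) as [H|H].
  + revert H; apply (not_avoids _ _ _ _ _ H2); generalize (pow2_ge_0 (Cmod (q / G))); intros; nra.
  + revert H; apply (not_avoids _ _ _ _ _ H3); generalize (pow2_ge_0 (Cmod (p / D))); intros; nra.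
Qed.

(** * Equal spacing of six directions at a hub *)

Lemma equally_spaced_perm (ds ds' : list pt) :
  Permutation ds ds' -> equally_spaced ds -> equally_spaced ds'.
Proof.
intros Hp (theta & ord & Ho & H); exists theta, ord; split.
- eapply Permutation_trans; [apply Permutation_sym; exact Hp | exact Ho].
- rewrite <- (Permutation_length Hp); exact H.
Qed.

(** Here [n] counts the steps of 60 degrees from [d1] counterclockwise to [d2]. The spacing order is
    a bijection with six slots, so the four pendant directions fill all the others. *)
Lemma equally_spaced_six (d1 d2 : C) (pen : idx4 -> C) :
  equally_spaced (d1 :: d2 :: map pen all_idx) ->
  exists n : nat, (1 <= n <= 5)%nat /\
    (exists l, 0 < l /\ d2 = (l * (d1 * cis (INR n * (PI / 3))))%C) /\
    forall k, (1 <= k <= 5)%nat -> k <> n ->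
      exists i l, 0 < l /\ pen i = (l * (d1 * cis (INR k * (PI / 3))))%C.
Proof.
intros (theta & ord & Hp & H).
set (ds := d1 :: d2 :: map pen all_idx) in *.
apply (Permutation_nth _ _ ((0, 0) : pt)) in Hp.
destruct Hp as (_ & f & Hb & Hi & Hn).
change (length ds) with 6%nat in *.
assert (Hs := proj1 (FinFun.bInjective_bSurjective Hb) Hi).
destruct (Hs 0%nat) as (m0 & M0 & F0); [lia|].
destruct (Hs 1%nat) as (m1 & M1 & F1); [lia|].
(* Slots are counted from the slot [m0] of [d1]; the second alternative is the wrap past the last
   slot, a full turn. *)
assert (Rel : forall m k, (m < 6)%nat -> (m = m0 + k \/ m + 6 = m0 + k)%nat ->
  exists l, 0 < l /\ nth (f m) ds (0, 0) = (l * (d1 * cis (INR k * (PI / 3))))%C).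
{ intros m k Hm Hk.
  destruct (H m Hm) as (l & Hl & E); destruct (H m0 M0) as (l0 & Hl0 & E0).
  rewrite Hn in E by exact Hm; rewrite Hn, F0 in E0 by exact M0.
  exists (l / l0); split; [now apply Rdiv_lt_0_compat|]; etransitivity; [exact E|]; clear E.
  change (d1 = (l0 * cos (theta + 2 * PI * INR m0 / INR 6),
                l0 * sin (theta + 2 * PI * INR m0 / INR 6))) in E0; rewrite E0.
  assert (Ec : cis (theta + 2 * PI * INR m / INR 6) =
    (cis (theta + 2 * PI * INR m0 / INR 6) * cis (INR k * (PI / 3)))%C).
  { rewrite <- cis_plus; destruct Hk as [->|Hk].
    - f_equal; rewrite plus_INR; simpl (INR 6); field.
    - apply (f_equal INR) in Hk; rewrite !plus_INR in Hk.
      replace (theta + 2 * PI * INR m0 / INR 6 + INR k * (PI / 3))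
        with (theta + 2 * PI * INR m / INR 6 + 2 * INR 1 * PI).
      + unfold cis; now rewrite cos_period, sin_period.
      + replace (INR k) with (INR m + INR 6 - INR m0) by lra; simpl; field. }
  transitivity (l * cis (theta + 2 * PI * INR m / INR 6))%C.
  { apply C_eq; rewrite ?Re_scal, ?Im_scal; reflexivity. }
  rewrite Ec.
  replace (l0 * cos (theta + 2 * PI * INR m0 / INR 6), l0 * sin (theta + 2 * PI * INR m0 / INR 6))
    with (l0 * cis (theta + 2 * PI * INR m0 / INR 6))%C
    by (apply C_eq; rewrite ?Re_scal, ?Im_scal; reflexivity).
  rewrite RtoC_div by lra; field; apply RtoC_neq_0; lra. }
assert (N01 : m0 <> m1) by congruence.
assert (exists n : nat, (1 <= n <= 5)%nat /\ (m1 = m0 + n \/ m1 + 6 = m0 + n)%nat)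
  as (n & Hn5 & Hnm).
{ destruct (Nat.lt_ge_cases m0 m1); [exists (m1 - m0)%nat | exists (m1 + 6 - m0)%nat]; lia. }
exists n; split; [exact Hn5|]; split.
- destruct (Rel m1 n M1 Hnm) as (l & Hl & E); rewrite F1 in E; exists l; split; assumption.
- intros k Hk Hkn.
  assert (exists m, (m < 6)%nat /\ (m = m0 + k \/ m + 6 = m0 + k)%nat) as (m & Hm & Hmk).
  { destruct (Nat.lt_ge_cases (m0 + k) 6); [exists (m0 + k)%nat | exists (m0 + k - 6)%nat]; lia. }
  destruct (Rel m k Hm Hmk) as (l & Hl & E).
  assert (Fm := Hb m Hm).
  assert (f m <> 0%nat) by (intros Z; rewrite <- F0 in Z; apply Hi in Z; lia).
  assert (f m <> 1%nat) by (intros Z; rewrite <- F1 in Z; apply Hi in Z; lia).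
  destruct (f m) as [|[|[|[|[|[|]]]]]]; try lia;
    [exists I0 | exists I1 | exists I2 | exists I3]; exists l; split; assumption.
Qed.

(** * The drawing *)

Lemma outside_conn (T P : pt -> Prop) (x y : pt) : (forall z, P z -> ~ T z) ->
  conn P y x -> outside_of T x -> outside_of T y.
Proof.
intros HP Hc [_ Ho]; split; [apply HP, (conn_l _ _ _ Hc)|].
intros M; destruct (Ho M) as (g & Hg & g0 & g1 & HT).
destruct (conn_trans (fun z => ~ T z) y x (g 1)) as (h & Hh & h0 & h1 & HhT).
- eapply conn_mono; [exact HP | exact Hc].
- exists g; do 3 (split; [assumption || reflexivity|]); exact HT.
- exists h; rewrite h1; do 3 (split; [assumption|]); exact HhT.
Qed.

Lemma outside_side (T : pt -> Prop) (a b c : C) (t1 t2 t3 : R) (x : C) :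
  - (PI / 2) < t1 < PI / 2 -> - (PI / 2) < t2 < PI / 2 -> - (PI / 2) < t3 < PI / 2 ->
  (forall z, ~ T z -> off a b c t1 t2 t3 z) ->
  outside_of T x -> 0 < side a b c t1 t2 t3 x.
Proof.
intros H1 H2 H3 HT [_ Ho].
destruct (side_far a b c t1 t2 t3 H1 H2 H3) as [M HM].
destruct (Ho M) as (g & Hg & g0 & g1 & HgT).
assert (K : conn (off a b c t1 t2 t3) x (g 1)).
{ exists g; do 3 (split; [assumption || reflexivity|]); intros t Ht; now apply HT, HgT. }
apply conn_side in K; specialize (HM (g 1)); rewrite Cmod2_alt in HM; specialize (HM g1).
apply Rnot_le_lt; intros L; nra.
Qed.

Lemma hub_angles (e1 e2 d1 d2 : C) (pen : idx4 -> C) :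
  equally_spaced (e1 :: e2 :: map pen all_idx) ->
  (exists l, 0 < l /\ e1 = (l * d1)%C) -> (exists l, 0 < l /\ e2 = (l * d2)%C) ->
  exists n : nat, (1 <= n <= 5)%nat /\
    (exists l, 0 < l /\ d2 = (l * (d1 * cis (2 * (INR n * (PI / 6)))))%C) /\
    forall k, (1 <= k <= 5)%nat -> k <> n ->
      exists i l, 0 < l /\ pen i = (l * (d1 * cis (INR k * (PI / 3))))%C.
Proof.
intros H (l1 & L1 & ->) (l2 & L2 & ->).
destruct (equally_spaced_six _ _ _ H) as (n & Hn & (l & Hl & E) & Hk).
exists n; split; [exact Hn|]; split.
- exists (/ l2 * l * l1); split.
  { repeat apply Rmult_lt_0_compat; try assumption; now apply Rinv_0_lt_compat. }
  replace (2 * (INR n * (PI / 6))) with (INR n * (PI / 3)) by field.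
  assert (N : RtoC l2 <> 0%C) by (apply RtoC_neq_0; lra).
  rewrite !RtoC_mult, RtoC_inv by lra.
  apply (Cmult_cancel_r _ _ _ N); rewrite Cmult_comm, E; field; exact N.
- intros k Hk5 Hkn; destruct (Hk k Hk5 Hkn) as (i & m & Hm & Ei).
  exists i, (m * l1); split; [now apply Rmult_lt_0_compat|].
  rewrite Ei, RtoC_mult; ring.
Qed.

(** Slot 1 is in the first sector unless the second triangle edge occupies it, and slot 5 is in the
    second sector with the same exception. A hub whose pendant edges all leave on one side therefore
    has [n] equal to 5 or 1. *)
Lemma pendants_near (a b c : C) (t1 t2 t3 pa pb pc : R) (n : nat) (g : idx4 -> arc) :
  simple a b c t1 t2 t3 pa pb pc -> pa = INR n * (PI / 6) -> (1 <= n <= 5)%nat ->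
  (forall i, arc_wf (g i) /\ arc_start (g i) = a) ->
  (forall k, (1 <= k <= 5)%nat -> k <> n -> exists i l, 0 < l /\
     dir_start (g i) = (l * (dep a b t1 * cis (INR k * (PI / 3))))%C) ->
  (n <> 1%nat -> exists i t, 0 < t <= 1 /\
     near (off a b c t1 t2 t3) a (dep a b t1) 0 (2 * pa) (arc_param (g i) t)) /\
  (n <> 5%nat -> exists i t, 0 < t <= 1 /\
     near (off a b c t1 t2 t3) a (dep a b t1) (2 * pa) (2 * PI) (arc_param (g i) t)).
Proof.
intros S Ep Hn Hg Hk; generalize PI_RGT_0; intros Hpi.
assert (Gen : forall k lo hi, (1 <= k <= 5)%nat -> k <> n -> lo < INR k * (PI / 3) < hi ->
  exists i t, 0 < t <= 1 /\
    near (off a b c t1 t2 t3) a (dep a b t1) lo hi (arc_param (g i) t)).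
{ intros k lo hi Hk5 Hkn Hlh; destruct (Hk k Hk5 Hkn) as (i & l & Hl & E).
  destruct (Hg i) as [Hw Hs].
  destruct (arc_param_slope (g i) Hw) as (f & m & Hm & Cf & F0 & Ef).
  destruct (near_curve _ _ _ _ _ _ _ _ _ S (m * l) (INR k * (PI / 3)) lo hi f) as (s0 & S0 & N).
  - now apply Rmult_lt_0_compat.
  - split.
    + assert (1 <= INR k <= 5).
      { split; [change 1 with (INR 1) | replace 5 with (INR 5) by (simpl; ring)];
          apply le_INR; lia. }
      split; nra.
    + rewrite Ep; intros Z.
      assert (INR k = INR n) by nra.
      apply Hkn, INR_eq; assumption.
  - exact Hlh.
  - exact Cf.
  - rewrite F0, E, RtoC_mult; ring.
  - set (s := Rmin s0 1 / 2).
    assert (0 < Rmin s0 1) by (apply Rmin_glb_lt; lra).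
    generalize (Rmin_l s0 1) (Rmin_r s0 1); intros.
    exists i, s; split; [unfold s; lra|].
    rewrite Ef, Hs; apply N; unfold s; lra. }
assert (Hn5 : 1 <= INR n <= 5).
{ split; [change 1 with (INR 1) | replace 5 with (INR 5) by (simpl; ring)]; apply le_INR; lia. }
split; intros Hne.
- apply (Gen 1%nat); [lia | congruence |].
  assert (2 <= INR n) by (replace 2 with (INR 2) by (simpl; ring); apply le_INR; lia).
  rewrite Ep; simpl (INR 1); split; nra.
- apply (Gen 5%nat); [lia | congruence |].
  assert (INR n <= 4) by (replace 4 with (INR 4) by (simpl; ring); apply le_INR; lia).
  rewrite Ep; replace (INR 5) with 5 by (simpl; ring); split; nra.
Qed.

Lemma edge_shape (pos : vert -> pt) (drw : edge -> arc) (e : edge) :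
  is_drawing pos drw -> let a := pos (fst (ends e)) in let b := pos (snd (ends e)) in
  exists th : R, - (PI / 2) < th < PI / 2 /\
    (forall x, arc_image (drw e) x <-> ~ avoids a b th x) /\
    (exists l, 0 < l /\ dir_start (drw e) = (l * dep a b th)%C) /\
    (exists l, 0 < l /\ dir_end (drw e) = (l * arr a b th)%C).
Proof.
intros [_ Hd] a b; destruct (Hd e) as (Hw & Hs & He).
destruct (arc_chordal (drw e) Hw) as (th & Ht & H).
rewrite Hs, He in H; exists th; split; [exact Ht | exact H].
Qed.

Lemma avoids_dec (a b x : C) (t : R) : avoids a b t x \/ ~ avoids a b t x.
Proof. unfold avoids; destruct (Rlt_dec 0 (slit (chordal a b t x))); tauto. Qed.

Theorem mainTheorem14 :
  ~ exists (pos : vert -> pt) (drw : edge -> arc),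
      is_lombardi pos drw /\ is_planar pos drw /\ respects_embedding drw.
Proof.
intros (pos & drw & [Hdraw Hsp] & Hpl & Hemb).
generalize PI_RGT_0; intros Hpi.
set (a := pos (Hub HA)); set (b := pos (Hub HB)); set (c := pos (Hub HC)).
assert (Inj := proj1 Hdraw).
destruct (edge_shape pos drw (Tri HA) Hdraw) as (t1 & T1 & I1' & S1 & R1).
destruct (edge_shape pos drw (Tri HB) Hdraw) as (t2 & T2 & I2' & S2 & R2).
destruct (edge_shape pos drw (Tri HC) Hdraw) as (t3 & T3 & I3' & S3 & R3).
cbn [ends fst snd next_hub] in *; fold a b c in I1', S1, R1, I2', S2, R2, I3', S3, R3.
assert (Spa := Hsp (Hub HA)); assert (Spb := Hsp (Hub HB)); assert (Spc := Hsp (Hub HC)).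
change (equally_spaced (dir_start (drw (Tri HA)) :: dir_end (drw (Tri HC)) ::
  map (fun i => dir_start (drw (Pen HA i))) all_idx)) in Spa.
change (equally_spaced (dir_end (drw (Tri HA)) :: dir_start (drw (Tri HB)) ::
  map (fun i => dir_start (drw (Pen HB i))) all_idx)) in Spb.
change (equally_spaced (dir_end (drw (Tri HB)) :: dir_start (drw (Tri HC)) ::
  map (fun i => dir_start (drw (Pen HC i))) all_idx)) in Spc.
(* At [b] and [c] the list of edges meets the arriving arc first; the swap puts the departing one in
   front, as at [a]. *)
apply (equally_spaced_perm _ _ (perm_swap _ _ _)) in Spb.
apply (equally_spaced_perm _ _ (perm_swap _ _ _)) in Spc.
destruct (hub_angles _ _ _ _ _ Spa S1 R3) as (na & Na & Aa & Ka).
destruct (hub_angles _ _ _ _ _ Spb S2 R1) as (nb & Nb & Ab & Kb).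
destruct (hub_angles _ _ _ _ _ Spc S3 R2) as (nc & Nc & Ac & Kc).
set (pa := INR na * (PI / 6)) in *; set (pb := INR nb * (PI / 6)) in *;
  set (pc := INR nc * (PI / 6)) in *.
assert (Bd : forall n, (1 <= n <= 5)%nat -> 0 < INR n * (PI / 6) < PI).
{ intros n Hn; assert (1 <= INR n <= 5).
  { split; [change 1 with (INR 1) | replace 5 with (INR 5) by (simpl; ring)];
      apply le_INR; lia. }
  split; nra. }
assert (Nab : a <> b) by (intros E; apply Inj in E; discriminate).
assert (Nbc : b <> c) by (intros E; apply Inj in E; discriminate).
assert (Nca : c <> a) by (intros E; apply Inj in E; discriminate).
assert (S : simple a b c t1 t2 t3 pa pb pc).
{ constructor; try assumption; try (apply Bd; assumption); intros x Hx.
  - destruct (avoids_dec a b x t1) as [?|A]; [tauto|].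
    destruct (avoids_dec b c x t2) as [?|B]; [tauto|].
    apply I1' in A; apply I2' in B.
    destruct (Hpl (Tri HA) (Tri HB) ltac:(discriminate) x A B) as (w & Hw1 & Hw2 & E).
    destruct Hw1 as [->| ->]; destruct Hw2 as [Z|Z]; try discriminate Z; contradiction.
  - destruct (avoids_dec b c x t2) as [?|A]; [tauto|].
    destruct (avoids_dec c a x t3) as [?|B]; [tauto|].
    apply I2' in A; apply I3' in B.
    destruct (Hpl (Tri HB) (Tri HC) ltac:(discriminate) x A B) as (w & Hw1 & Hw2 & E).
    destruct Hw1 as [->| ->]; destruct Hw2 as [Z|Z]; try discriminate Z; contradiction.
  - destruct (avoids_dec c a x t3) as [?|A]; [tauto|].
    destruct (avoids_dec a b x t1) as [?|B]; [tauto|].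
    apply I3' in A; apply I1' in B.
    destruct (Hpl (Tri HC) (Tri HA) ltac:(discriminate) x A B) as (w & Hw1 & Hw2 & E).
    destruct Hw1 as [->| ->]; destruct Hw2 as [Z|Z]; try discriminate Z; contradiction. }
set (P := off a b c t1 t2 t3).
assert (PT : forall z, P z -> ~ triangle_set drw z).
{ intros z (P1 & P2 & P3) ([] & Hz);
    [apply I1' in Hz | apply I2' in Hz | apply I3' in Hz]; contradiction. }
assert (TP : forall z, ~ triangle_set drw z -> P z).
{ intros z Hz; split; [|split].
  - destruct (avoids_dec a b z t1) as [|A]; [assumption|].
    exfalso; apply Hz; exists HA; now apply I1'.
  - destruct (avoids_dec b c z t2) as [|A]; [assumption|].
    exfalso; apply Hz; exists HB; now apply I2'.
  - destruct (avoids_dec c a z t3) as [|A]; [assumption|].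
    exfalso; apply Hz; exists HC; now apply I3'. }
assert (S' := simple_rot _ _ _ _ _ _ _ _ _ S).
assert (S'' := simple_rot _ _ _ _ _ _ _ _ _ S').
assert (Pb : forall z, off b c a t2 t3 t1 z <-> P z).
{ intros z; split; intros H; [apply off_rot, off_rot, H | apply off_rot, H]. }
assert (Pc : forall z, off c a b t3 t1 t2 z <-> P z).
{ intros z; split; intros H; [apply off_rot, H | apply off_rot, off_rot, H]. }
assert (Wf : forall h i, arc_wf (drw (Pen h i)) /\ arc_start (drw (Pen h i)) = pos (Hub h)).
{ intros h i; destruct (proj2 Hdraw (Pen h i)) as (W1 & W2 & _); split; assumption. }
destruct (pendants_near _ _ _ _ _ _ _ _ _ na (fun i => drw (Pen HA i)) S eq_refl Na (Wf HA) Ka)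
  as [PLa PRa].
destruct (pendants_near _ _ _ _ _ _ _ _ _ nb (fun i => drw (Pen HB i)) S' eq_refl Nb (Wf HB) Kb)
  as [PLb PRb].
destruct (pendants_near _ _ _ _ _ _ _ _ _ nc (fun i => drw (Pen HC i)) S'' eq_refl Nc (Wf HC) Kc)
  as [PLc PRc].
set (La := near P a (dep a b t1) 0 (2 * pa)); set (Ra := near P a (dep a b t1) (2 * pa) (2 * PI)).
set (Lb := near P b (dep b c t2) 0 (2 * pb)); set (Rb := near P b (dep b c t2) (2 * pb) (2 * PI)).
set (Lc := near P c (dep c a t3) 0 (2 * pc)); set (Rc := near P c (dep c a t3) (2 * pc) (2 * PI)).
(* Sliding along [ab] and [bc] links the first sectors of all three hubs to [x1] and the second
   sectors to [y1]. *)
destruct (slide _ _ _ _ _ _ _ _ _ S) as [(x1 & X1a & X1b) (y1 & Y1a & Y1b)].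
destruct (slide _ _ _ _ _ _ _ _ _ S') as [(x2 & X2b & X2c) (y2 & Y2b & Y2c)].
apply (near_mono _ P _ _ _ _ _ (fun z => proj1 (Pb z))) in X2b, X2c, Y2b, Y2c.
assert (free_L : forall p, 0 < p < PI -> forall phi, 0 < phi < 2 * p -> free_dir p phi)
  by (intros p Hp phi Hphi; split; lra).
assert (free_R : forall p, 0 < p < PI -> forall phi, 2 * p < phi < 2 * PI -> free_dir p phi)
  by (intros p Hp phi Hphi; split; lra).
assert (Cb : forall lo hi x y, (forall phi, lo < phi < hi -> free_dir pb phi) ->
  near P b (dep b c t2) lo hi x -> near P b (dep b c t2) lo hi y -> conn P x y).
{ intros lo hi x y Hf Hx Hy; apply (conn_mono _ P _ _ (fun z => proj1 (Pb z))).
  apply (near_near _ _ _ _ _ _ _ _ _ S' lo hi); [exact Hf | |];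
    eapply near_mono; try eassumption; intros z; apply Pb. }
assert (Cc : forall lo hi x y, (forall phi, lo < phi < hi -> free_dir pc phi) ->
  near P c (dep c a t3) lo hi x -> near P c (dep c a t3) lo hi y -> conn P x y).
{ intros lo hi x y Hf Hx Hy; apply (conn_mono _ P _ _ (fun z => proj1 (Pc z))).
  apply (near_near _ _ _ _ _ _ _ _ _ S'' lo hi); [exact Hf | |];
    eapply near_mono; try eassumption; intros z; apply Pc. }
assert (Pb0 := Bd nb Nb); assert (Pc0 := Bd nc Nc); assert (Pa0 := Bd na Na).
fold pa in Pa0; fold pb in Pb0; fold pc in Pc0.
assert (CLa : forall x, La x -> conn P x x1).
{ intros x Hx; apply (near_near _ _ _ _ _ _ _ _ _ S 0 (2 * pa)); auto. }
assert (CRa : forall x, Ra x -> conn P x y1).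
{ intros x Hx; apply (near_near _ _ _ _ _ _ _ _ _ S (2 * pa) (2 * PI)); auto. }
assert (CLb : forall x, Lb x -> conn P x x1) by (intros x Hx; apply (Cb 0 (2 * pb)); auto).
assert (CRb : forall x, Rb x -> conn P x y1) by (intros x Hx; apply (Cb (2 * pb) (2 * PI)); auto).
assert (CLc : forall x, Lc x -> conn P x x1).
{ intros x Hx; apply conn_trans with x2; [apply (Cc 0 (2 * pc)) | apply CLb]; auto. }
assert (CRc : forall x, Rc x -> conn P x y1).
{ intros x Hx; apply conn_trans with y2; [apply (Cc (2 * pc) (2 * PI)) | apply CRb]; auto. }
assert (J : side a b c t1 t2 t3 x1 * side a b c t1 t2 t3 y1 < 0)
  by exact (side_jump _ _ _ _ _ _ _ _ _ S _ _ X1a Y1a).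
assert (Out : forall x y, conn P x y -> outside_of (triangle_set drw) x ->
  0 < side a b c t1 t2 t3 y).
{ intros x y Hc Ho; apply (outside_side _ a b c t1 t2 t3 y T1 T2 T3 TP).
  apply (outside_conn _ P x y PT); [apply conn_sym; exact Hc | exact Ho]. }
assert (wE : forall n, (n = 1 \/ n = 5)%nat -> cis (2 * (INR n * (PI / 6))) =
  (1 / 2, (if Nat.eqb n 1 then 1 else -1) * (sqrt 3 / 2))).
{ intros n [->| ->]; simpl Nat.eqb; cbv iota.
  - replace (2 * (INR 1 * (PI / 6))) with (PI / 3) by (simpl; field).
    unfold cis; rewrite cos_PI3, sin_PI3; f_equal; ring.
  - replace (2 * (INR 5 * (PI / 6))) with (- (PI / 3) + 2 * INR 1 * PI) by (simpl; field).
    unfold cis; rewrite cos_period, sin_period, cos_neg, sin_neg, cos_PI3, sin_PI3.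
    f_equal; ring. }
assert (s3 : sqrt 3 * sqrt 3 = 3) by (apply sqrt_sqrt; lra).
destruct (Rlt_dec 0 (side a b c t1 t2 t3 x1)) as [Hp|Hp].
- assert (Hy : ~ 0 < side a b c t1 t2 t3 y1) by nra.
  (* A pendant edge of [a] in the second sector would be outside and joined to [y1], making [side]
     positive there. *)
  assert (Ea : na = 5%nat).
  { destruct (Nat.eq_dec na 5) as [|N]; [assumption|]; exfalso; apply Hy.
    destruct (PRa N) as (i & t & Ht & Hn); eapply Out; [apply CRa, Hn | apply (Hemb HA i t Ht)]. }
  assert (Eb : nb = 5%nat).
  { destruct (Nat.eq_dec nb 5) as [|N]; [assumption|]; exfalso; apply Hy.
    destruct (PRb N) as (i & t & Ht & Hn); eapply Out; [|apply (Hemb HB i t Ht)].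
    apply CRb; eapply near_mono; [|exact Hn]; intros z; apply Pb. }
  (* No sign is known for inside points. A pendant edge of [c] in the first sector is instead
     joined, through [x1], to a pendant edge of [a], which is outside; one exists in that sector
     since [na] is 5. *)
  assert (Ec : nc = 1%nat).
  { destruct (Nat.eq_dec nc 1) as [|N]; [assumption|]; exfalso.
    destruct (PLc N) as (i & t & Ht & Hn); destruct (Hemb HC i t Ht) as [_ Hi]; apply Hi.
    destruct PLa as (j & u & Hu & Hm); [lia|].
    apply (outside_conn _ P (arc_param (drw (Pen HA j)) u) _ PT); [|apply (Hemb HA j u Hu)].
    apply conn_trans with x1; [apply CLc | apply conn_sym, CLa, Hm].
    eapply near_mono; [|exact Hn]; intros z; apply Pc. }
  apply (no_mixed_triangle _ _ _ _ _ _ _ _ _ (cis (2 * pa)) S); unfold pa, pb, pc;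
    rewrite ?Ea, ?Eb, ?Ec; try reflexivity; rewrite !wE by auto; simpl Nat.eqb; cbv iota;
    apply C_eq; unfold Re, Im; simpl; lra.
- assert (Hy : 0 < side a b c t1 t2 t3 y1).
  { apply Rnot_le_lt; intros L; apply Hp, Rnot_le_lt; intros L'; nra. }
  assert (Ea : na = 1%nat).
  { destruct (Nat.eq_dec na 1) as [|N]; [assumption|]; exfalso; apply Hp.
    destruct (PLa N) as (i & t & Ht & Hn); eapply Out; [apply CLa, Hn | apply (Hemb HA i t Ht)]. }
  assert (Eb : nb = 1%nat).
  { destruct (Nat.eq_dec nb 1) as [|N]; [assumption|]; exfalso; apply Hp.
    destruct (PLb N) as (i & t & Ht & Hn); eapply Out; [|apply (Hemb HB i t Ht)].
    apply CLb; eapply near_mono; [|exact Hn]; intros z; apply Pb. }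
  assert (Ec : nc = 5%nat).
  { destruct (Nat.eq_dec nc 5) as [|N]; [assumption|]; exfalso.
    destruct (PRc N) as (i & t & Ht & Hn); destruct (Hemb HC i t Ht) as [_ Hi]; apply Hi.
    destruct PRa as (j & u & Hu & Hm); [lia|].
    apply (outside_conn _ P (arc_param (drw (Pen HA j)) u) _ PT); [|apply (Hemb HA j u Hu)].
    apply conn_trans with y1; [apply CRc | apply conn_sym, CRa, Hm].
    eapply near_mono; [|exact Hn]; intros z; apply Pc. }
  apply (no_mixed_triangle _ _ _ _ _ _ _ _ _ (cis (2 * pa)) S); unfold pa, pb, pc;
    rewrite ?Ea, ?Eb, ?Ec; try reflexivity; rewrite !wE by auto; simpl Nat.eqb; cbv iota;
    apply C_eq; unfold Re, Im; simpl; lra.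
Qed.
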